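(* If $\alpha\in(0,1)$, $\lambda\in\mathbb{R}$ and $y\in C^1[0,b]$, then for all $t\in(0,b]$ there exists some $c\in(0,t)$ such that $${}^{TR}\mathcal{D}^{\alpha,\lambda}_{\Psi}\,y(c)=\frac{e^{\lambda(\Psi(t)-\Psi(0))}y(t)-\frac{(\Psi(t)-\Psi(0))^{\alpha-1}}{\Gamma(\alpha)}\left[\mathcal{I}^{1-\alpha}_{\Psi}\left(e^{\lambda(\Psi(t)-\Psi(0))}y(t)\right)\right]_{t=0}}{(\Psi(t)-\Psi(0))^{\alpha}\,E_{1,\alpha+1}\big(\lambda(\Psi(t)-\Psi(0))\big)}.$$
   Context: Throughout, $b>0$ is fixed and $\Psi$ is a smooth monotonic real function on $[0,b]$ with $\Psi'>0$ almost everywhere. For $\alpha>0$, $\lambda\in\mathbb{R}$, the $\Psi$-tempered fractional integral is $${}^{T}\mathcal{I}^{\alpha,\lambda}_{\Psi}y(t)=\frac{1}{\Gamma(\alpha)}\int_0^t\Psi'(s)(\Psi(t)-\Psi(s))^{\alpha-1}e^{-\lambda(\Psi(t)-\Psi(s))}y(s)\,\mathrm{d}s,$$ and the $\Psi$-Riemann--Liouville integral $\mathcal{I}^{\alpha}_{\Psi}$ is the case $\lambda=0$. For $\alpha\in(0,1)$, the $\Psi$-tempered fractional derivative of Riemann--Liouville type is ${}^{TR}\mathcal{D}^{\alpha,\lambda}_{\Psi}y(t)=\left(\frac{1}{\Psi'(t)}\frac{\mathrm{d}}{\mathrm{d}t}+\lambda\right){}^{T}\mathcal{I}^{1-\alpha,\lambda}_{\Psi}y(t)$.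 $[\,\cdot\,]_{t=0}$ denotes the value at $t=0$ (limit as $t\to0^+$). $E_{p,q}(z)=\sum_{k=0}^\infty \frac{z^k}{\Gamma(pk+q)}$ is the two-parameter Mittag-Leffler function.
   Formalization: The formal theorem also assumes Ψ′(s) ≠ 0 for all 0 < s < t; with Ψ′ > 0 only almost everywhere the claim fails, e.g. Ψ(t) = (t−1)³+1, y = max(t−1,0)^{3/2}, α = 1/2, λ = 0, t = b = 2. *)

(* Defs.v *)
From HB Require Import structures.
From mathcomp Require Import all_boot all_order all_algebra.
From mathcomp Require Import all_classical all_reals all_analysis.

Set Implicit Arguments.
Unset Strict Implicit.
Unset Printing Implicit Defensive.

Import Order.TTheory GRing.Theory Num.Theory.
Import numFieldNormedType.Exports.

Local Open Scope classical_set_scope.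
Local Open Scope ring_scope.

(* f is of class C^n on the closed interval [a, b] with a < b: F k is the k-th
   derivative of f, continuous up to the endpoints, where it is then also the
   one-sided derivative. Values of f outside [a, b] play no role. *)
Definition class_C {R : realType} (n : nat) (a b : R) (f : R -> R) : Prop :=
  exists F : nat -> R -> R,
    [/\ F 0%N = f,
        forall k, (k <= n)%N -> {within `[a, b], continuous (F k)} &
        forall k, (k < n)%N -> forall x, x \in `]a, b[ ->
          is_derive x 1 (F k) (F k.+1 x)].

Definition smooth {R : realType} (a b : R) (f : R -> R) : Prop :=
  forall n, class_C n a b f.

(* Meaningful for 0 < x only; no other arguments occur below. *)
Definition Gamma {R : realType} (x : R) : R :=
  \int[lebesgue_measure]_(s in `]0, +oo[) (s `^ (x - 1) * expR (- s)).

(* Meant for 0 <= p and 0 < q. *)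
Definition MittagLeffler {R : realType} (p q z : R) : R :=
  limn (series (fun k : nat => z ^+ k / Gamma (p * k%:R + q))).

(* derive1 Psi is the two-sided derivative, so it may differ from the derivative
   relative to [0, b] at the endpoints; this is immaterial for the integral. *)
Definition tempered_integral {R : realType} (Psi : R -> R) (alpha lambda : R)
    (y : R -> R) (t : R) : R :=
  (Gamma alpha)^-1 *
  \int[lebesgue_measure]_(s in `[0, t])
     (derive1 Psi s * (Psi t - Psi s) `^ (alpha - 1)
      * expR (- lambda * (Psi t - Psi s)) * y s).

Definition RL_integral {R : realType} (Psi : R -> R) (alpha : R)
    (y : R -> R) : R -> R :=
  tempered_integral Psi alpha 0 y.

(* The formula defines the derivative at t only when derive1 Psi t != 0 and the
   integral is derivable at t; elsewhere it takes a default value. *)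
Definition tempered_RL_derivative {R : realType} (Psi : R -> R)
    (alpha lambda : R) (y : R -> R) (t : R) : R :=
  (derive1 Psi t)^-1 * derive1 (tempered_integral Psi (1 - alpha) lambda y) t
  + lambda * tempered_integral Psi (1 - alpha) lambda y t.

Definition value_at_0 {R : realType} (f : R -> R) : R :=
  lim (f t @[t --> 0^'+]).

(* Main.v *)
Require Import Defs.
From HB Require Import structures.
From mathcomp Require Import all_boot all_order all_algebra.
From mathcomp Require Import all_classical all_reals all_analysis.
From mathcomp Require Import measurable_realfun ring lra.

(* Write U := Psi - Psi 0, X := U t and w (U s) := exp (lambda U s) y s.  The
   substitution u = U s turns the tempered integral of order 1 - alpha into
   exp (- lambda u) (I^(1-alpha) w) (u), where I^a is convolution with the kernel
   x^(a-1) / Gamma a, and the tempered derivative into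
   exp (- lambda u) (I^(1-alpha) w)' (u).  As w is bounded, the bracket at 0
   vanishes.  With phi := I^alpha (exp (lambda .)), whose value at X is
   X^alpha E_{1,alpha+1} (lambda X), and m := w X / phi X, the function
   r := w - m phi vanishes at X, and the claim is that K := I^(1-alpha) r has a
   critical point in ]0, X[.  Otherwise K would be, up to a sign, increasing
   from K 0 = 0.  But I^alpha K is a primitive of r by the semigroup property,
   and I^alpha of an increasing function has a positive left derivative at X,
   contradicting r X = 0. *)

Set Implicit Arguments.
Unset Strict Implicit.
Unset Printing Implicit Defensive.

Import Order.TTheory GRing.Theory Num.Theory.
Import numFieldNormedType.Exports.

Local Open Scope classical_set_scope.
Local Open Scope ring_scope.

(** The direct route, writing [w X] as [I^alpha] of [(I^(1-alpha) w)'] and applying a mean value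
    theorem for integrals, meets a derivative that may blow up like [u^(-alpha)] at 0 when [w 0] is
    nonzero. Arguing by contradiction needs only derivability in []0, X[] and continuity of [K] on
    [[0, X]]: Rolle's theorem turns the absence of critical points into injectivity, and continuity
    turns that into monotonicity. The function [phi] is the one whose tempered derivative is
    constantly 1: [I^(1-alpha) phi] is the primitive of [exp (lambda .)], and the outer factor
    [exp (- lambda u)] cancels its derivative. Subtracting [m phi] therefore lowers the tempered
    derivative by exactly [m]. In the variable [u], [w] involves the inverse of [Psi], so [w']
    carries a factor [1 / Psi'] that may be unbounded near both ends. Hence derivatives are
    controlled on open intervals only, and [w] itself is extended to a continuous function on the
    line. *)

Local Notation mu := lebesgue_measure.

(** * Affine changes of variables and convolution *)

Section affine.
Context {R : realType}.
Implicit Types (f : R -> \bar R) (c d : R).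

Lemma measurable_affine c d : measurable_fun [set: _] (fun x : R => c * x + d).
Proof. by apply: measurable_funD => //; exact: measurable_funM. Qed.

(** Uniqueness of Lebesgue measure: the pushforward along [x |-> c * x + d], scaled by [|c|], gives
    each []a, b]] its length. For [c < 0] the preimage is closed on the left instead, which does not
    affect lengths. *)
Lemma ge0_integral_affine f c d : c != 0 ->
  measurable_fun [set: _] f -> (forall x, 0 <= f x)%E ->
  (\int[mu]_x f x = `|c|%:E * \int[mu]_x f (c * x + d)%R)%E.
Proof.
move=> c0 mf f0.
have P (a b : R) : lebesgue_measure (`]a, b]%classic : set R) =
    (`|c|%:E * lebesgue_measure ((fun x => c * x + d)%R @^-1` `]a, b] : set R))%E.
  have [ab|ba] := ltP a b; last first.
    by rewrite set_itv_ge ?bnd_simp -?leNgt// preimage_set0 !measure0 mule0.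
  have [cp|cn|/esym/eqP] := ltgtP 0 c; last by rewrite (negbTE c0).
    rewrite [X in _ = (_ * lebesgue_measure X)%E](_ : _ =
        `](a - d) / c, (b - d) / c]%classic); last first.
      apply/seteqP; split => x /=; rewrite !in_itv/= ltr_pdivrMr// ler_pdivlMr//;
        by rewrite ltrBlDr lerBrDr mulrC.
    rewrite !lebesgue_measure_itv/= !lte_fin ab ltr_pM2r ?invr_gt0// ltrD2r ab.
    by rewrite -!EFinD -EFinM gtr0_norm//; congr EFin; field; rewrite gt_eqF.
  rewrite [X in _ = (_ * lebesgue_measure X)%E](_ : _ =
      `[(b - d) / c, (a - d) / c[%classic); last first.
    apply/seteqP; split => x /=; rewrite !in_itv/= ltr_ndivlMr// ler_ndivrMr//;
      by rewrite ltrBlDr lerBrDr (mulrC x) andbC.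
  rewrite !lebesgue_measure_itv/= !lte_fin ab ltr_nM2r ?invr_lt0// ltrD2r ab.
  by rewrite -!EFinD -EFinM ltr0_norm//; congr EFin; field; rewrite lt_eqF.
pose phi : measurableTypeR R -> measurableTypeR R := fun x => c * x + d.
have mphi : measurable_fun setT phi by exact: measurable_affine.
pose k : {nonneg R} := NngNum (normr_ge0 c).
pose nu' : {measure set (measurableTypeR R) -> \bar R} :=
  mscale k (pushforward mu phi).
pose nu := nu' mphi.
have E A : measurable A -> mu A = nu A.
  by apply: lebesgue_measure_unique => _ [[a b] _ <-]; exact: P.
transitivity (\int[nu]_x f x)%E.
  by apply: eq_measure_integral => A mA _; exact: E.
rewrite ge0_integral_mscale//=; congr (_ * _)%E.
by rewrite ge0_integral_pushforward.
Qed.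

End affine.

Section convolution_theory.
Context {R : realType}.
Local Open Scope ereal_scope.
Implicit Types (f g h : R -> \bar R).

(** Extended-real values let Tonelli apply to nonnegative functions without any integrability
    condition; finiteness is settled afterwards. *)
Definition convolution f g (x : R) : \bar R := \int[mu]_y (f (x - y)%R * g y).

Lemma ge0_integral_shift f (d : R) :
  measurable_fun [set: _] f -> (forall x, 0 <= f x) ->
  \int[mu]_x f (x + d)%R = \int[mu]_x f x.
Proof.
move=> mf f0; rewrite [RHS](ge0_integral_affine d (oner_neq0 R))// normr1 mul1e.
by under [RHS]eq_integral do rewrite mul1r.
Qed.

Lemma measurable_fun_sub f (x : R) : measurable_fun [set: _] f ->
  measurable_fun [set: R] (fun y : R => f (x - y)%R).
Proof.
move=> mf; apply: (measurableT_comp mf).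
by apply: measurable_funB => //; exact: measurable_cst.
Qed.

Lemma measurable_fun_subr f (x : R) : measurable_fun [set: _] f ->
  measurable_fun [set: R] (fun y : R => f (y - x)%R).
Proof.
move=> mf; apply: (measurableT_comp mf).
by apply: measurable_funB => //; exact: measurable_cst.
Qed.

Lemma convolution_ge0 f g x : (forall x, 0 <= f x) -> (forall x, 0 <= g x) ->
  0 <= convolution f g x.
Proof. by move=> f0 g0; apply: integral_ge0 => y _; exact: mule_ge0. Qed.

Lemma measurable_fun_diff2 f : measurable_fun [set: _] f ->
  measurable_fun [set: R * R] (fun p : R * R => f (p.1 - p.2)%R).
Proof.
move=> mf; apply: (measurableT_comp mf).
by apply: measurable_funB; [exact: measurable_fst|exact: measurable_snd].
Qed.

Let measurable_convolution2 f g : measurable_fun [set: _] f -> measurable_fun [set: _] g ->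
  measurable_fun [set: R * R] (fun p : R * R => f (p.1 - p.2)%R * g p.2).
Proof.
move=> mf mg; apply: emeasurable_funM; first exact: measurable_fun_diff2.
exact: (measurableT_comp mg measurable_snd).
Qed.

Lemma integral_convolution f g : measurable_fun [set: _] f -> measurable_fun [set: _] g ->
  (forall x, 0 <= f x) -> (forall x, 0 <= g x) ->
  \int[mu]_x convolution f g x = (\int[mu]_x f x) * (\int[mu]_x g x).
Proof.
move=> mf mg f0 g0.
have If0 : 0 <= \int[mu]_x f x by exact: integral_ge0.
rewrite /convolution (@fubini_tonelli _ _ (measurableTypeR R)
  (measurableTypeR R) R mu mu _ (measurable_convolution2 mf mg))/=; last first.
  by move=> p; exact: mule_ge0.
rewrite muleC -ge0_integralZr//.
apply: eq_integral => y _.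
rewrite ge0_integralZr//; last exact: measurable_fun_subr.
by rewrite (ge0_integral_shift (- y)) // muleC.
Qed.

(** Tonelli exchanges the two integrations and a shift by [z] straightens the inner one. The
    semigroup property of fractional integrals rests on this law. *)
Lemma convolutionA f g h : measurable_fun [set: _] f -> measurable_fun [set: _] g ->
  measurable_fun [set: _] h -> (forall x, 0 <= f x) -> (forall x, 0 <= g x) ->
  (forall x, 0 <= h x) -> convolution f (convolution g h) = convolution (convolution f g) h.
Proof.
move=> mf mg mh f0 g0 h0; apply/funext => x; rewrite /convolution.
pose F (p : R * R) := f (x - p.1)%R * (g (p.1 - p.2)%R * h p.2).
have mF : measurable_fun [set: _] F.
  apply: emeasurable_funM; last exact: measurable_convolution2.
  exact: (measurableT_comp (measurable_fun_sub x mf) measurable_fst).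
transitivity (\int[mu]_y \int[mu]_z F (y, z)).
  apply: eq_integral => y _; rewrite -ge0_integralZl//.
    apply: emeasurable_funM => //; exact: measurable_fun_sub.
  by move=> z _; exact: mule_ge0.
rewrite fubini_tonelli//; last by move=> p; rewrite /F !mule_ge0.
apply: eq_integral => z _; rewrite /F/=.
under eq_integral do rewrite muleA.
rewrite ge0_integralZr; first last.
- exact: h0.
- by move=> y _; exact: mule_ge0.
- by apply: emeasurable_funM; [exact: measurable_fun_sub|exact: measurable_fun_subr].
- exact: measurableT.
congr (_ * _).
rewrite -(@ge0_integral_shift _ z); first last.
- by move=> y; exact: mule_ge0.
- by apply: emeasurable_funM; [exact: measurable_fun_sub|exact: measurable_fun_subr].
by apply: eq_integral => y _; rewrite addrK opprD addrA addrAC.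
Qed.

Lemma convolutionC f g : measurable_fun [set: _] f -> measurable_fun [set: _] g ->
  (forall x, 0 <= f x) -> (forall x, 0 <= g x) -> convolution f g = convolution g f.
Proof.
move=> mf mg f0 g0; apply/funext => x; rewrite /convolution.
rewrite (@ge0_integral_affine _ _ (-1)%R x)//; first last.
- by move=> y; exact: mule_ge0.
- by apply: emeasurable_funM => //; exact: measurable_fun_sub.
rewrite normrN1 mul1e; apply: eq_integral => y _.
by rewrite mulN1r muleC; congr (g _ * f _); ring.
Qed.

End convolution_theory.

(** * The Gamma function and the Riemann-Liouville kernels *)

Section gamma.
Context {R : realType}.
Implicit Types (a b x : R).

(** For [a < 1] the integrand is singular at 0, so the fundamental theorem of calculus is used on
    [[e n, x]] and monotone convergence does the rest. *)
Lemma integral_powR a x : 0 < a -> 0 < x ->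
  (\int[mu]_(s in `]0%R, x]) (s `^ (a - 1))%:E = (x `^ a / a)%:E)%E.
Proof.
move=> a0 x0.
(* [n.+2] rather than [n.+1] keeps [e n < x] already for [n = 0]. *)
pose e (n : nat) : R := x / n.+2%:R.
have e0 n : 0 < e n by rewrite divr_gt0.
have eE : e n @[n --> \oo] --> (0 : R).
  rewrite -(mulr0 x); apply: cvgMr.
  by rewrite (cvg_shiftS (@harmonic R)); exact: cvg_harmonic.
have ltex n : e n < x by rewrite ltr_pdivrMr// ltr_pMr// ltr1n.
have U : \bigcup_n `[e n, x]%classic = `]0, x]%classic.
  apply/seteqP; split => [s [n _]|s] /=; rewrite !in_itv/= => /andP[h1 h2].
    by rewrite h2 (lt_le_trans (e0 n)).
  near \oo => n; exists n => //=; rewrite in_itv/= h2 andbT.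
  by near: n; have /cvgr_le := eE; apply.
rewrite -U.
have H : (\int[mu]_(s in `[e n, x]) (s `^ (a - 1))%:E)%E @[n --> \oo] -->
   (\int[mu]_(s in \bigcup_n `[e n, x]%classic) (s `^ (a - 1))%:E)%E.
  apply: ge0_nondecreasing_set_cvg_integral => //.
  - move=> m n mn; rewrite subsetEset; apply: subset_itvr.
    by rewrite bnd_simp ler_pM2l// lef_pV2 ?posrE// ler_nat !ltnS.
  - move=> n; apply/measurable_EFinP.
    by apply: (@measurable_funS _ _ _ _ setT) => //; exact: measurable_powR.
  - by move=> n s _; rewrite lee_fin powR_ge0.
apply: (cvg_unique _ H) => //.
rewrite (_ : (fun n => _) = fun n => (x `^ a / a - e n `^ a / a)%:E); last first.
  apply/funext => n.
  have pos s : s \in `[e n, x] -> 0 < s.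
    by rewrite in_itv/= => /andP[+ _]; exact: lt_le_trans.
  have D (s : R) : 0 < s -> is_derive s 1 (fun u : R => u `^ a / a) (s `^ (a - 1)).
    move=> s0; have := is_derive1_powR a s0 => Ds.
    rewrite [X in is_derive _ _ X _](_ : _ = a^-1 \*: (fun u : R => u `^ a)); last first.
      by apply/funext => u; rewrite /GRing.scale/= mulrC.
    apply: (is_derive_eq (is_deriveZ a^-1 Ds)).
    by rewrite /GRing.scale/= mulKf// gt_eqF.
  have C (s : R) : 0 < s -> {for s, continuous (fun u : R => u `^ a / a)}.
    by move=> s0; apply/differentiable_continuous/derivable1_diffP; case: (D s s0).
  rewrite (@continuous_FTC2 _ _ (fun u : R => u `^ a / a))//.
  - apply: continuous_in_subspaceT => s; rewrite inE/= => /pos s0.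
    apply/differentiable_continuous/derivable1_diffP.
    by apply: derivable_powR; rewrite in_itv/= s0.
  - split.
    + by move=> s /subset_itv_oo_cc/pos /D [].
    + by apply: cvg_at_right_filter; apply: C.
    + by apply: cvg_at_left_filter; apply: C.
  - move=> s /subset_itv_oo_cc/pos /D ?; rewrite derive1E.
    exact: derive_val.
apply: cvg_EFin; first exact: nearW.
rewrite -[X in _ --> X]subr0; apply: cvgB; first exact: cvg_cst.
rewrite -(mul0r a^-1); apply: cvgMl.
have /cvg_at_rightP := powR_cvg0 a0; apply; split => //.
Unshelve. all: by end_near. Qed.

(** The power kernel before division by Gamma: its convolution law up to a constant is what yields
    the functional equation and the finiteness of Gamma. *)
Definition kern a x : R := if 0 < x then x `^ (a - 1) else 0.

Lemma kern_ge0 a x : 0 <= kern a x.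
Proof. by rewrite /kern; case: ifPn => // _; rewrite powR_ge0. Qed.

Lemma kern_pos a x : 0 < x -> kern a x = x `^ (a - 1).
Proof. by rewrite /kern => ->. Qed.

Lemma kern_le0 a x : x <= 0 -> kern a x = 0.
Proof. by rewrite /kern ltNge => ->. Qed.

Lemma measurable_kern a : measurable_fun [set: R] (kern a).
Proof.
apply: measurable_fun_ifT => //; exact: measurable_fun_ltr.
Qed.

Lemma kernM a c x : 0 < c -> kern a (c * x) = c `^ (a - 1) * kern a x.
Proof.
move=> c0; have [x0|x0] := ltP 0 x.
  by rewrite !kern_pos ?mulr_gt0// powRM// ltW.
by rewrite !kern_le0 ?mulr0// pmulr_rle0.
Qed.

Let ek a := EFin \o kern a.

Let mek a : measurable_fun [set: R] (ek a).
Proof. by apply/measurable_EFinP; exact: measurable_kern. Qed.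

Let ek0 a x : (0 <= ek a x)%E. Proof. by rewrite lee_fin kern_ge0. Qed.

Lemma convolution_kern_le0 a b x : x <= 0 -> convolution (ek a) (ek b) x = 0%E.
Proof.
move=> x0; rewrite /convolution integral0_eq// => y _.
have [y0|y0] := ltP 0 y; last by rewrite /ek/= (kern_le0 b y0) mule0.
by rewrite /ek/= (@kern_le0 a (x - y)) ?mul0e// subr_le0 (le_trans x0)// ltW.
Qed.

(** Homogeneity: replacing [y] by [x * y] extracts [x^(a-1) * x^(b-1) * x]. The remaining constant,
    the convolution at 1, is the Beta function. *)
Lemma convolution_kern_scale a b x :
  convolution (ek a) (ek b) x = (convolution (ek a) (ek b) 1 * ek (a + b) x)%E.
Proof.
have [x0|x0] := ltP 0 x; last first.
  by rewrite convolution_kern_le0// /ek/= kern_le0// mule0.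
rewrite /convolution (@ge0_integral_affine _ _ x 0) ?gt_eqF//; first last.
- by move=> y; rewrite mule_ge0.
- by apply: emeasurable_funM => //; exact: measurable_fun_sub.
rewrite gtr0_norm//.
under eq_integral => y _.
  rewrite addr0 -[X in ek a (X - _)]mulr1 -mulrBr /ek/= !kernM// -EFinM mulrACA.
  rewrite -powRD; last by rewrite (gt_eqF x0) implybT.
  rewrite EFinM.
  over.
rewrite ge0_integralZl//; first last.
- by rewrite lee_fin powR_ge0.
- by move=> y _; rewrite lee_fin mulr_ge0 ?kern_ge0.
- apply/measurable_EFinP/measurable_funM; last exact: measurable_kern.
  by apply/measurable_EFinP; exact: (measurable_fun_sub 1 (mek a)).
rewrite muleA -EFinM muleC; congr (_ * _)%E; rewrite /ek/= kern_pos//.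
by congr EFin; rewrite -{1}(powRr1 (ltW x0)) -powRD ?(gt_eqF x0) ?implybT//;
  congr (_ `^ _); ring.
Qed.

Lemma convolution_kern_exp a b x :
  (convolution (fun x => (kern a x * expR (- x))%:E) (fun x => (kern b x * expR (- x))%:E) x
   = convolution (ek a) (ek b) x * (expR (- x))%:E)%E.
Proof.
rewrite /convolution -ge0_integralZr//; first last.
- by move=> y _; rewrite mule_ge0.
- by apply: emeasurable_funM; [exact: (measurable_fun_sub x (mek a))|exact: mek].
apply: eq_integral => y _; rewrite /ek /= -!EFinM mulrACA -expRD.
by congr (_ * expR _)%:E; ring.
Qed.

Let eGamma a := (\int[mu]_x (kern a x * expR (- x))%:E)%E.

Let measurable_kern_exp a :
  measurable_fun [set: R] (fun x => (kern a x * expR (- x))%:E).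
Proof.
apply/measurable_EFinP/measurable_funM; first exact: measurable_kern.
by apply: measurableT_comp => //; exact: measurableT_comp.
Qed.

Let eGamma_ge0 a : (0 <= eGamma a)%E.
Proof. by apply: integral_ge0 => x _; rewrite lee_fin mulr_ge0 ?kern_ge0 ?expR_ge0. Qed.

Lemma GammaE a : Gamma a = fine (eGamma a).
Proof.
rewrite /Gamma /Rintegral integral_mkcond; congr fine.
apply: eq_integral => x _; rewrite patchE mem_setE in_itv/= andbT /kern.
by case: ifPn => // _; rewrite mul0r.
Qed.

(** The weight [exp (- x)] passes through convolutions, because
    [exp (- (x - y)) * exp (- y) = exp (- x)]. The identity lives in the extended reals, so it is
    available before finiteness is known. *)
Lemma eGamma_convolution a b :
  (eGamma a * eGamma b = convolution (ek a) (ek b) 1 * eGamma (a + b))%E.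
Proof.
rewrite /eGamma -integral_convolution//; first last.
- by move=> x; rewrite lee_fin mulr_ge0 ?kern_ge0 ?expR_ge0.
- by move=> x; rewrite lee_fin mulr_ge0 ?kern_ge0 ?expR_ge0.
rewrite -ge0_integralZl//; first last.
- exact: convolution_ge0.
- by move=> x _; rewrite lee_fin mulr_ge0 ?kern_ge0 ?expR_ge0.
- exact: measurable_kern_exp.
apply: eq_integral => x _.
by rewrite convolution_kern_exp convolution_kern_scale -muleA.
Qed.
Lemma convolution_kern1 a : 0 < a -> (convolution (ek a) (ek 1) 1 = (a^-1)%:E)%E.
Proof.
move=> a0; rewrite convolutionC//.
have := integral_powR a0 ltr01; rewrite powR1 div1r => <-.
rewrite -integral_itv_bndo_bndc; last first.
  apply/measurable_EFinP.
  by apply: (@measurable_funS _ _ _ _ setT) => //; exact: measurable_powR.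
rewrite [RHS]integral_mkcond; apply: eq_integral => y _.
rewrite patchE mem_setE in_itv/= /ek/= /kern subr_gt0.
case: ltP => y1; case: ltP => y0 //=; rewrite ?mule0 ?mul0e//.
by rewrite -EFinM subrr powRr0 mul1r.
Qed.

Let eGamma1 : eGamma 1 = 1%E.
Proof.
rewrite -(@integral_exponential_pdf R _ ltr01).
transitivity (\int[mu]_(x in `]0%R, +oo[) (@exponential_pdf R 1 x)%:E)%E.
  rewrite [RHS]integral_mkcond; apply: eq_integral => x _.
  rewrite patchE mem_setE in_itv/= andbT /kern; case: ltP => x0.
    by rewrite exponential_pdfE ?ltW// subrr powRr0; congr EFin; rewrite !mul1r mulN1r.
  by rewrite mul0r.
rewrite integral_itv_obnd_cbnd; last first.
  apply/measurable_EFinP; apply: (@measurable_funS _ _ _ _ setT) => //.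
  exact: measurable_exponential_pdf.
rewrite integral_mkcond; apply: eq_integral => x _.
rewrite patchE mem_setE in_itv/= andbT; case: leP => // x0.
by rewrite lt0_exponential_pdf.
Qed.

(** The case [b = 1] of [eGamma_convolution], where the Beta constant is [1 / a]; no integration by
    parts on an unbounded interval is involved. *)
Let eGammaS a : 0 < a -> (eGamma (a + 1) = a%:E * eGamma a)%E.
Proof.
move=> a0; have := eGamma_convolution a 1.
rewrite eGamma1 mule1 (convolution_kern1 a0) => ->.
by rewrite muleA -EFinM (divff (lt0r_neq0 a0)) mul1e.
Qed.

(** For an argument [c] in []0, 1]] the integrand is at most [x^(c-1)] on []0, 1]] and [exp (- x)]
    beyond. Larger arguments come down to these by the functional equation. *)
Let eGamma_fin a : 0 < a -> (eGamma a \is a fin_num).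
Proof.
move=> a0.
have small c : 0 < c <= 1 -> (eGamma c < +oo)%E.
  move=> /andP[c0 c1].
  apply: (@le_lt_trans _ _ (\int[mu]_x ((ek c \_ `]0%R, 1%R]) x +
      (kern 1 x * expR (- x))%:E))%E).
    apply: ge0_le_integral => //.
    - by move=> x _; rewrite lee_fin mulr_ge0 ?kern_ge0 ?expR_ge0.
    - exact: measurable_kern_exp.
    - apply: emeasurable_funD; last exact: measurable_kern_exp.
      apply/(measurable_restrictT (ek c)) => //; exact: (@measurable_funS _ _ _ _ setT).
    move=> x _; have [x0|x0] := ltP 0 x; last first.
      by rewrite !kern_le0// !mul0r adde0 patchE; case: ifP => // _; rewrite ek0.
    rewrite patchE mem_setE in_itv/= x0 /= /ek /= !kern_pos//; have [x1|x1] := leP x 1.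
      rewrite -EFinD lee_fin (@le_trans _ _ (x `^ (c - 1)))//.
        rewrite -[leRHS]mulr1 ler_wpM2l ?powR_ge0// -expR0 ler_expR.
        by rewrite oppr_le0 ltW.
      by rewrite lerDl mulr_ge0 ?powR_ge0 ?expR_ge0.
    rewrite add0e lee_fin ler_wpM2r ?expR_ge0//.
    by apply: ler_powR; [exact: ltW|lra].
  rewrite ge0_integralD//; first last.
  - exact: measurable_kern_exp.
  - by move=> x _; rewrite lee_fin mulr_ge0 ?kern_ge0 ?expR_ge0.
  - apply/(measurable_restrictT (ek c)) => //; exact: (@measurable_funS _ _ _ _ setT).
  - by move=> x _; apply: erestrict_ge0.
  rewrite -/(eGamma 1) eGamma1 -integral_mkcond.
  rewrite (_ : (\int[mu]_(x in _) _)%E = (1 `^ c / c)%:E); last first.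
    rewrite -integral_powR//; apply: eq_integral => x.
    by rewrite inE/= in_itv/= => /andP[x0 _]; rewrite /ek /= kern_pos.
  by rewrite -EFinD ltry.
have [n an] : exists n : nat, a <= n%:R.
  by exists (Num.truncn a).+1; rewrite ltW// truncnS_gt.
elim: n a a0 an => [|n IH] a a0 an; first by rewrite leNgt a0 in an.
have [a1|a1] := leP a 1.
  by rewrite ge0_fin_numE ?eGamma_ge0// small// a0 a1.
rewrite -(subrK 1 a) eGammaS ?subr_gt0// fin_numM//.
by rewrite IH// ?subr_gt0// lerBlDr natr1.
Qed.

Lemma Gamma_gt0 a : 0 < a -> 0 < Gamma a.
Proof.
move=> a0; rewrite GammaE fine_gt0// -ge0_fin_numE ?eGamma_ge0// eGamma_fin// andbT.
(* On []0, 1]] the exponential is at least [exp (-1)], and the power has integral [1 / a] there. *)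
have h : (0 < (expR (-1) * (1 `^ a / a))%:E)%E.
  by rewrite lte_fin powR1 mulr_gt0 ?expR_gt0// divr_gt0.
apply: (lt_le_trans h).
have mp : measurable_fun (`]0, 1]%classic : set R) (fun s : R => (s `^ (a - 1))%:E).
  apply/measurable_EFinP.
  by apply: (@measurable_funS _ _ _ _ setT) => //; exact: measurable_powR.
rewrite EFinM -integral_powR// -ge0_integralZl//; last first.
  by move=> s _; rewrite lee_fin powR_ge0.
have -> : eGamma a = (\int[mu]_(x in `]0%R, +oo[) (kern a x * expR (- x))%:E)%E.
  rewrite [RHS]integral_mkcond; apply: eq_integral => x _.
  rewrite patchE mem_setE in_itv/= andbT; have [x0|x0] := ltP 0 x => //.
  by rewrite kern_le0// mul0r.
apply: (@le_trans _ _ (\int[mu]_(x in `]0%R, 1%R]) (kern a x * expR (- x))%:E)%E).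
  apply: ge0_le_integral => //.
  - by move=> x _; rewrite mule_ge0 ?lee_fin ?expR_ge0 ?powR_ge0.
  - by apply: emeasurable_funM => //; exact: measurable_cst.
  - by apply: (@measurable_funS _ _ _ _ setT) => //; exact: measurable_kern_exp.
  - move=> x /=; rewrite in_itv/= => /andP[x0 x1].
    by rewrite -EFinM lee_fin kern_pos// mulrC ler_wpM2l ?powR_ge0// ler_expR lerN2.
apply: ge0_subset_integral => //.
- by apply: (@measurable_funS _ _ _ _ setT) => //; exact: measurable_kern_exp.
- by move=> x _; rewrite lee_fin mulr_ge0 ?kern_ge0 ?expR_ge0.
- exact: subset_itvl.
Qed.

Let eGammaK a : 0 < a -> eGamma a = (Gamma a)%:E.
Proof. by move=> a0; rewrite GammaE fineK// eGamma_fin. Qed.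

Lemma GammaS a : 0 < a -> Gamma (a + 1) = a * Gamma a.
Proof.
move=> a0; apply: EFin_inj; rewrite EFinM -!eGammaK ?eGammaS//.
by rewrite addr_gt0.
Qed.

Lemma Gamma1 : Gamma 1 = 1 :> R.
Proof. by rewrite GammaE eGamma1. Qed.

Lemma Gamma_fact n : Gamma n.+1%:R = n`!%:R :> R.
Proof.
elim: n => [|n IH]; first by rewrite Gamma1.
by rewrite -natr1 GammaS// IH factS natrM.
Qed.

(** The cut at 0 lets integrals over [[0, u]] be read as convolutions on the whole line, where
    Tonelli and translation invariance are available. *)
Definition frac_kernel a x : R := if 0 < x then x `^ (a - 1) / Gamma a else 0.

Lemma frac_kernelE a x : frac_kernel a x = (Gamma a)^-1 * kern a x.
Proof. by rewrite /frac_kernel /kern; case: ifP; rewrite ?mulr0// mulrC. Qed.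

Lemma frac_kernel_le0 a x : x <= 0 -> frac_kernel a x = 0.
Proof. by move=> x0; rewrite frac_kernelE kern_le0// mulr0. Qed.

Lemma frac_kernel_ge0 a x : 0 < a -> 0 <= frac_kernel a x.
Proof.
by move=> a0; rewrite frac_kernelE mulr_ge0 ?kern_ge0// invr_ge0 ltW ?Gamma_gt0.
Qed.

Lemma measurable_frac_kernel a : measurable_fun [set: R] (frac_kernel a).
Proof.
rewrite (_ : frac_kernel a = fun x => (Gamma a)^-1 * kern a x); last first.
  by apply/funext => x; rewrite frac_kernelE.
by apply: measurable_funM => //; exact: measurable_kern.
Qed.

(* The constant in front of the power kernel is identified by integrating
   against [expR (- x)], which turns the convolution into the product
   [Gamma a * Gamma b]: this is Euler's formula for the Beta function. *)
Lemma convolution_frac_kernel a b : 0 < a -> 0 < b ->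
  convolution (EFin \o frac_kernel a) (EFin \o frac_kernel b) =
  EFin \o frac_kernel (a + b).
Proof.
move=> a0 b0; apply/funext => x; have ab0 := addr_gt0 a0 b0.
have Ga := Gamma_gt0 a0; have Gb := Gamma_gt0 b0; have Gab := Gamma_gt0 ab0.
have GG : 0 <= (Gamma a)^-1 * (Gamma b)^-1.
  by apply: mulr_ge0; rewrite invr_ge0; [exact: (ltW Ga)|exact: (ltW Gb)].
transitivity (((Gamma a)^-1 * (Gamma b)^-1)%:E * convolution (ek a) (ek b) x)%E.
  rewrite /convolution -ge0_integralZl//; first last.
  - by move=> y _; rewrite mule_ge0.
  - by apply: emeasurable_funM; [exact: (measurable_fun_sub x (mek a))|exact: mek].
  by apply: eq_integral => y _; rewrite /= !frac_kernelE -!EFinM mulrACA.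
have C : (convolution (ek a) (ek b) 1 = (Gamma a * Gamma b / Gamma (a + b))%:E)%E.
  have := eGamma_convolution a b; rewrite !eGammaK// => /eqP.
  rewrite -EFinM EFinM => /eqP E.
  rewrite [in RHS]EFinM EFinM E -muleA -EFinM divff ?mule1 ?gt_eqF//.
rewrite convolution_kern_scale C /= frac_kernelE -!EFinM; congr EFin.
move: (Gamma a) (Gamma b) (Gamma (a + b)) (kern (a + b) x)
  (lt0r_neq0 Ga) (lt0r_neq0 Gb).
by move=> x1 x2 x3 k x1n0 x2n0; rewrite -invfM -(mulrA (x1 * x2)) mulKf ?mulf_neq0.
Qed.

Lemma frac_kernel1 x : frac_kernel 1 x = ((0 < x)%R)%:R.
Proof.
by rewrite /frac_kernel; case: ifP => // _; rewrite subrr powRr0 Gamma1 divr1.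
Qed.

Lemma frac_kernelS n x : 0 < x -> frac_kernel n.+1%:R x = x ^+ n / n`!%:R.
Proof.
move=> x0; rewrite /frac_kernel x0 Gamma_fact; congr (_ / _).
by rewrite -natr1 addrK powR_mulrn// ltW.
Qed.

Lemma frac_kernelM a c x : 0 < c -> frac_kernel a (c * x) = c `^ (a - 1) * frac_kernel a x.
Proof. by move=> c0; rewrite !frac_kernelE kernM// mulrCA. Qed.

End gamma.

(** * Fractional integrals *)

Section Rintegral_affine.
Context {R : realType}.
Implicit Types (f : R -> R) (c d p q : R).

Let affine_restrict f c d p q (x : R) : 0 < c ->
  (f \_ `[c * p + d, c * q + d]) (c * x + d) =
  ((fun y => f (c * y + d)) \_ `[p, q]) x.
Proof.
by move=> c0; rewrite !patchE !mem_setE !in_itv/= !lerD2r !ler_pM2l.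
Qed.

(** Positive and negative parts reduce this to the nonnegative case. Integrability of the
    transformed function comes first, since [fine] respects products only at finite values. *)
Lemma Rintegral_affine_itv f c d p q : 0 < c ->
  mu.-integrable `[c * p + d, c * q + d] (EFin \o f) ->
  mu.-integrable `[p, q] (EFin \o (fun x => f (c * x + d))) /\
  \int[mu]_(x in `[c * p + d, c * q + d]) f x =
  c * \int[mu]_(x in `[p, q]) f (c * x + d).
Proof.
move=> c0 fi.
have mD a b : measurable (`[a, b]%classic : set R) by [].
pose F := f \_ `[c * p + d, c * q + d].
have FE : (fun x => F (c * x + d)) = ((fun y => f (c * y + d)) \_ `[p, q]).
  by apply/funext => x; rewrite /F affine_restrict.
have iF : mu.-integrable [set: R] (EFin \o F).
  by rewrite -restrict_EFin; apply/integrable_restrict => //; rewrite setTI.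
have mF : measurable_fun [set: R] F by move/integrableP: iF => [/measurable_EFinP].
have cn0 : c != 0 by rewrite gt_eqF.
have aff (g : R -> \bar R) : measurable_fun [set: R] g -> (forall x, 0 <= g x)%E ->
    (\int[mu]_x g x = c%:E * \int[mu]_x g (c * x + d)%R)%E.
  by move=> mg g0; rewrite (ge0_integral_affine d cn0)// gtr0_norm.
have mFa : measurable_fun [set: R] (fun x => F (c * x + d)).
  apply: (measurableT_comp mF); exact: measurable_affine.
have iFa : mu.-integrable [set: R] (EFin \o (fun x => F (c * x + d))).
  apply/integrableP; split; first exact/measurable_EFinP.
  move/integrableP: iF => [_]; rewrite (aff (fun x => `|(EFin \o F) x|%E))//; last first.
    by apply: measurableT_comp => //; exact/measurable_EFinP.
  move=> h; rewrite -[ltLHS]mul1e -(mulVf cn0) EFinM -muleA lte_mul_pinfty//.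
  by rewrite lee_fin invr_ge0 ltW.
split.
  rewrite -(setTI `[p, q]%classic); apply/(integrable_restrict mu (mD p q)) => //.
  by rewrite restrict_EFin -FE.
rewrite [LHS]Rintegral_mkcond [X in _ = c * X]Rintegral_mkcond -/F -FE.
apply: EFin_inj; rewrite EFinM /Rintegral !fineK//; try exact: integrable_fin_num.
have mF' : measurable_fun [set: R] (EFin \o F) by exact/measurable_EFinP.
rewrite [LHS]integralE [X in (_ * X)%E]integralE muleBr//; last first.
  apply: fin_num_adde_defr.
  by apply: integrable_fin_num => //; exact: integrable_funepos.
congr (_ - _)%E.
  rewrite aff//; last exact: measurable_funepos.
  by congr (_ * _)%E; apply: eq_integral => x _; rewrite !funeposE.
rewrite aff//; last exact: measurable_funeneg.
by congr (_ * _)%E; apply: eq_integral => x _; rewrite !funenegE.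
Qed.

End Rintegral_affine.

Section frac_int.
Context {R : realType}.
Implicit Types (f g : R -> R) (a b u : R).

Definition frac_int a f u : R :=
  \int[mu]_(s in `[0, u]) (frac_kernel a (u - s) * f s).

Let measurable_frac_kernel_sub a u :
  measurable_fun [set: R] (fun s => frac_kernel a (u - s)).
Proof.
have mk : measurable_fun [set: R] (EFin \o frac_kernel a).
  apply/measurable_EFinP; exact: measurable_frac_kernel.
by apply/measurable_EFinP; exact: (measurable_fun_sub u mk).
Qed.

Lemma integral_frac_kernel2 a b u : 0 < a -> 0 < b ->
  (\int[mu]_(s in `[0%R, u]) (frac_kernel a (u - s) * frac_kernel b s)%:E =
   (frac_kernel (a + b) u)%:E)%E.
Proof.
move=> a0 b0; have := congr1 (@^~ u) (convolution_frac_kernel a0 b0).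
rewrite /= => <-; rewrite integral_mkcond /convolution; apply: eq_integral => s _.
rewrite patchE mem_setE in_itv/= -EFinM; case: ifPn => //.
rewrite negb_and -!ltNge => /orP[s0|us].
  by rewrite (frac_kernel_le0 b (ltW s0)) mulr0.
by rewrite (@frac_kernel_le0 _ a (u - s)) ?mul0r// subr_le0 ltW.
Qed.

Lemma integral_frac_kernel a u : 0 < a ->
  (\int[mu]_(s in `[0%R, u]) (frac_kernel a (u - s))%:E =
   (frac_kernel (a + 1) u)%:E)%E.
Proof.
move=> a0; rewrite -[RHS](integral_frac_kernel2 u a0 ltr01).
(* [frac_kernel 1] stands in for the constant 1 but vanishes at 0, so both integrals are first moved
   to []0, u]]. *)
rewrite -[LHS]integral_itv_obnd_cbnd; last first.
  by apply/measurable_EFinP; apply: (@measurable_funS _ _ _ _ setT).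
rewrite -[RHS]integral_itv_obnd_cbnd; last first.
  apply/measurable_EFinP; apply: (@measurable_funS _ _ _ _ setT) => //.
  by apply: measurable_funM => //; exact: measurable_frac_kernel.
apply: eq_integral => s; rewrite inE/= in_itv/= => /andP[s0 _].
by rewrite frac_kernel1 s0 mulr1.
Qed.

Lemma integrable_frac_kernel a u : 0 < a ->
  mu.-integrable `[0, u] (EFin \o (fun s => frac_kernel a (u - s))).
Proof.
move=> a0; apply/integrableP; split.
  apply/measurable_EFinP; apply: (@measurable_funS _ _ _ _ setT) => //.
  exact: measurable_frac_kernel_sub.
rewrite (_ : (\int[mu]_(s in _) _)%E = (frac_kernel (a + 1) u)%:E) ?ltry//.
rewrite -integral_frac_kernel//; apply: eq_integral => s _.
by rewrite /= ger0_norm// frac_kernel_ge0.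
Qed.

Lemma within_continuous_bounded_itv f p q : {within `[p, q], continuous f} ->
  exists2 M, 0 < M & forall s, s \in `[p, q] -> `|f s| <= M.
Proof.
move=> cf; have [pq|qp] := leP p q; last first.
  exists 1 => // s; rewrite in_itv/= => /andP[h1 h2].
  by have := le_trans h1 h2; rewrite leNgt qp.
have cn : {within `[p, q], continuous (fun s => `|f s|)}.
  by move=> s; apply: continuous_comp; [exact: cf|exact: norm_continuous].
have [c _ cM] := EVT_max pq cn.
exists (`|f c| + 1); first by rewrite ltr_wpDl.
by move=> s /cM /le_trans; apply; rewrite lerDl.
Qed.

Lemma continuous_bounded_itv f p q : continuous f ->
  exists2 M, 0 < M & forall s, s \in `[p, q] -> `|f s| <= M.
Proof.
by move=> cf; apply: within_continuous_bounded_itv; exact: continuous_subspaceT.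
Qed.

Lemma integrable_frac_int a f u : 0 < a -> continuous f ->
  mu.-integrable `[0, u] (EFin \o (fun s => frac_kernel a (u - s) * f s)).
Proof.
move=> a0 cf.
rewrite (_ : _ \o _ = ((EFin \o (fun s => frac_kernel a (u - s))) \* (EFin \o f))%E)//.
apply: integrableMl => //; first exact: integrable_frac_kernel.
- apply: (@measurable_funS _ _ _ _ setT) => //.
  exact: continuous_measurable_fun.
have [M M0 fM] := continuous_bounded_itv 0 u cf.
exists M; split; first by rewrite num_real.
move=> N MN s /= su; rewrite (le_trans _ (ltW MN))// fM//.
Qed.

Lemma frac_int_lt0 a f u : u < 0 -> frac_int a f u = 0.
Proof.
move=> u0; rewrite /frac_int set_itv_ge ?Rintegral_set0// bnd_simp.
by rewrite -ltNge.
Qed.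

Lemma frac_intD a f g u : 0 < a -> continuous f -> continuous g ->
  frac_int a (fun s => f s + g s) u = frac_int a f u + frac_int a g u.
Proof.
move=> a0 cf cg; rewrite /frac_int -RintegralD//; try exact: integrable_frac_int.
by apply: eq_Rintegral => s _; rewrite mulrDr.
Qed.

Lemma frac_intZ a f c u : 0 < a -> continuous f ->
  frac_int a (fun s => c * f s) u = c * frac_int a f u.
Proof.
move=> a0 cf; rewrite /frac_int -RintegralZl//; last exact: integrable_frac_int.
by apply: eq_Rintegral => s _; rewrite mulrCA.
Qed.

Lemma le_frac_int a f g u : 0 < a -> continuous f -> continuous g ->
  (forall s, s \in `[0, u] -> f s <= g s) -> frac_int a f u <= frac_int a g u.
Proof.
move=> a0 cf cg fg; apply: le_Rintegral => //; try exact: integrable_frac_int.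
by move=> s su; rewrite ler_wpM2l ?frac_kernel_ge0// fg.
Qed.

Lemma frac_int_cst a c u : 0 < a ->
  frac_int a (fun=> c) u = c * frac_kernel (a + 1) u.
Proof.
move=> a0; have := integral_frac_kernel u a0.
rewrite /frac_int RintegralZr//; last exact: integrable_frac_kernel.
by rewrite /Rintegral => ->; rewrite mulrC.
Qed.

(** On []0, u]] the normalised monomial is itself the kernel of order [n + 1], so this is the
    convolution law of the kernels. *)
Lemma frac_int_pow a n u : 0 < a -> 0 < u ->
  frac_int a (fun s => s ^+ n / n`!%:R) u = frac_kernel (a + n.+1%:R) u.
Proof.
move=> a0 u0; apply: EFin_inj; rewrite -integral_frac_kernel2//.
rewrite /frac_int /Rintegral fineK; last first.
  apply: integrable_fin_num => //; apply: integrable_frac_int => //.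
  by move=> s; apply: cvgMl; exact: exprn_continuous.
rewrite -[LHS]integral_itv_obnd_cbnd; last first.
  apply/measurable_EFinP; apply: (@measurable_funS _ _ _ _ setT) => //.
  by apply: measurable_funM => //; apply: measurable_funM => //; exact: exprn_measurable.
rewrite -[RHS]integral_itv_obnd_cbnd; last first.
  apply/measurable_EFinP; apply: (@measurable_funS _ _ _ _ setT) => //.
  by apply: measurable_funM => //; exact: measurable_frac_kernel.
apply: eq_integral => s; rewrite inE/= in_itv/= => /andP[s0 _].
by rewrite frac_kernelS.
Qed.

End frac_int.

Section frac_int_theory.
Context {R : realType}.
Implicit Types (f g : R -> R) (a b u : R).

(** Frees both the domain and the singularity of the kernel from [u]: continuity, derivability and
    monotonicity in [u] become questions about [f (u * s)] on a fixed interval. *)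
Lemma frac_int_scale a f u : 0 < a -> continuous f -> 0 <= u ->
  frac_int a f u =
  u `^ a * \int[mu]_(s in `[0, 1]) (frac_kernel a (1 - s) * f (u * s)).
Proof.
move=> a0 cf; rewrite le_eqVlt => /predU1P[<-|u0].
  by rewrite /frac_int set_itv1 Rintegral_set1 powR0 ?mul0r// gt_eqF.
have := @Rintegral_affine_itv _ (fun s => frac_kernel a (u - s) * f s) u 0 0 1 u0.
rewrite !addr0 mulr0 mulr1 => /(_ (integrable_frac_int _ a0 cf)) [_ E].
rewrite /frac_int E.
have E2 s : frac_kernel a (u - (u * s + 0)) * f (u * s + 0) =
    u `^ (a - 1) * (frac_kernel a (1 - s) * f (u * s)).
  by rewrite addr0 -{1}(mulr1 u) -mulrBr frac_kernelM// mulrA.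
under eq_Rintegral do rewrite E2.
rewrite RintegralZl//.
  by rewrite mulrA mulr_powRB1// ltW.
have cfu : continuous (fun s => f (u * s)).
  by move=> s; apply: continuous_comp; [exact: mulrl_continuous|exact: cf].
exact: integrable_frac_int.
Qed.

(** Dominated convergence in the scaled form. Writing the factor with [Num.max u 0] makes that form
    valid for negative [u] too, where the fractional integral is 0. *)
Lemma continuous_frac_int a f : 0 < a -> continuous f -> continuous (frac_int a f).
Proof.
move=> a0 cf.
pose H u := \int[mu]_(s in `[0, 1]) (frac_kernel a (1 - s) * f (u * s)).
have -> : frac_int a f = fun u => (Num.max u 0) `^ a * H u.
  apply/funext => u; have [u0|u0] := leP 0 u.
    by rewrite frac_int_scale.
  by rewrite frac_int_lt0// powR0 ?mul0r// gt_eqF.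
have cfu u : continuous (fun s => f (u * s)).
  by move=> s; apply: continuous_comp; [exact: mulrl_continuous|exact: cf].
have cH : continuous H.
  move=> u.
  pose B := `|u| + 1.
  have [M M0 fM] := continuous_bounded_itv (- B) B cf.
  apply: (@continuity_under_integral _ _ _ mu (fun u s => frac_kernel a (1 - s) * f (u * s))
    `[0, 1]%classic _ (- B) B _ _ (fun s => frac_kernel a (1 - s) * M)) => //.
  - by move=> v _; exact: integrable_frac_int.
  - apply/aeW => s _ v _; apply: cvgMr.
    by apply: continuous_comp; [exact: mulrr_continuous|exact: cf].
  - by apply: (@integrable_frac_int _ _ (cst M)) => // v; exact: cvg_cst.
  - move=> v /=; rewrite in_itv/= => /andP[v1 v2]; apply/aeW => s /=.
    rewrite in_itv/= => /andP[s0 s1].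
    rewrite normrM ger0_norm ?frac_kernel_ge0// ler_wpM2l ?frac_kernel_ge0// fM//.
    have vB : `|v| <= B by rewrite ler_norml (ltW v1) ltW.
    rewrite in_itv/= -ler_norml normrM (ger0_norm s0) -[leRHS]mulr1.
    by rewrite ler_pM.
  - rewrite inE/= in_itv/= /B; case: (ger0P u) => u0; lra.
have cP : continuous (fun u : R => (Num.max u 0) `^ a).
  move=> u; have [u0|u0|<-] := ltgtP 0 u.
  - have : {for u, continuous (fun u : R => u `^ a)}.
      apply/differentiable_continuous/derivable1_diffP.
      by apply: derivable_powR; rewrite in_itv/= u0.
    rewrite /prop_for /continuous_at (max_idPl (ltW u0)); apply: cvg_trans.
    apply: near_eq_cvg; near=> x; rewrite (max_idPl _)//.
    by apply: ltW; near: x; exact: lt_nbhsr.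
  - rewrite /continuous_at (max_idPr (ltW u0)) powR0 ?gt_eqF//.
    apply: cvg_near_cst; near=> x; rewrite (max_idPr _) ?powR0 ?gt_eqF//.
    by apply: ltW; near: x; exact: lt_nbhsl.
  - apply/left_right_continuousP; rewrite maxxx powR0 ?gt_eqF//; split.
      apply: cvg_near_cst; near=> x; rewrite (max_idPr _) ?powR0 ?gt_eqF//.
    have := powR_cvg0 a0; apply: cvg_trans; apply: near_eq_cvg.
    by near=> x; rewrite (max_idPl _).
move=> u; apply: cvgM; [exact: cP|exact: cH].
Unshelve. all: by end_near. Qed.

Lemma frac_int_convolution a f u : 0 < a -> continuous f -> (forall s, 0 <= f s) ->
  ((frac_int a f u)%:E = convolution (EFin \o frac_kernel a)
    (fun s => (if 0 <= s then f s else 0)%:E) u)%E.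
Proof.
move=> a0 cf f0; rewrite /frac_int /Rintegral fineK; last first.
  by apply: integrable_fin_num => //; exact: integrable_frac_int.
rewrite integral_mkcond /convolution; apply: eq_integral => s _.
rewrite patchE mem_setE in_itv/= -EFinM; case: (leP 0 s) => s0 /=; last first.
  by rewrite mulr0.
by case: leP => // us; rewrite /frac_kernel ifN ?mul0r// -leNgt subr_le0 ltW.
Qed.

Lemma frac_int_ge0 a f u : 0 < a -> (forall s, 0 <= f s) -> 0 <= frac_int a f u.
Proof.
by move=> a0 f0; apply: Rintegral_ge0 => s _; rewrite mulr_ge0 ?frac_kernel_ge0.
Qed.

Let measurable_pos_part f : continuous f ->
  measurable_fun [set: R] (fun s => (if 0 <= s then f s else 0)%:E).
Proof.
move=> cf; apply/measurable_EFinP; apply: measurable_fun_ifT => //.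
  exact: (@measurable_fun_ler _ _ _ setT (cst 0) id).
exact: continuous_measurable_fun.
Qed.

Let frac_int_semigroup_ge0 a b f u : 0 < a -> 0 < b -> continuous f ->
  (forall s, 0 <= f s) ->
  frac_int a (frac_int b f) u = frac_int (a + b) f u.
Proof.
move=> a0 b0 cf f0; apply: EFin_inj.
rewrite frac_int_convolution//; [|exact: continuous_frac_int|
  by move=> s; exact: frac_int_ge0].
rewrite (frac_int_convolution u (addr_gt0 a0 b0) cf f0).
rewrite -[in RHS](convolution_frac_kernel a0 b0) -convolutionA//; first last.
- by move=> s; rewrite lee_fin; case: ifP.
- by move=> s; rewrite lee_fin frac_kernel_ge0.
- by move=> s; rewrite lee_fin frac_kernel_ge0.
- exact: measurable_pos_part.
- by apply/measurable_EFinP; exact: measurable_frac_kernel.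
- by apply/measurable_EFinP; exact: measurable_frac_kernel.
(* The inner fractional integral already vanishes on negative arguments, so the cut at 0 leaves it
   unchanged. *)
congr (convolution _ _ u); apply/funext => s.
rewrite -frac_int_convolution//; case: leP => // s0.
by rewrite frac_int_lt0.
Qed.

Lemma frac_int_semigroup a b f u : 0 < a -> 0 < b -> continuous f ->
  frac_int a (frac_int b f) u = frac_int (a + b) f u.
Proof.
move=> a0 b0 cf.
(* Tonelli covers nonnegative functions; positive and negative parts of a continuous function stay
   continuous, and linearity recombines them. *)
pose p s := Num.max (f s) 0; pose n s := Num.max (- f s) 0.
have cp : continuous p.
  by move=> s; apply: (@continuous_max _ _ f (cst 0)); [exact: cf|exact: cvg_cst].
have cn : continuous n.
  move=> s; apply: (@continuous_max _ _ (fun s => - f s) (cst 0)).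
    by apply: cvgN; exact: cf.
  exact: cvg_cst.
have cn1 : continuous (fun s => (- 1) * n s) by move=> s; apply: cvgMr; exact: cn.
have p0 s : 0 <= p s by rewrite le_max lexx orbT.
have n0 s : 0 <= n s by rewrite le_max lexx orbT.
have fE : f = fun s => p s + (- 1) * n s.
  apply/funext => s; rewrite mulN1r /p /n -{2}oppr0 -oppr_min opprK.
  by rewrite addr_max_min addr0.
have E c v : 0 < c -> frac_int c f v = frac_int c p v + (-1) * frac_int c n v.
  by move=> c0; rewrite fE frac_intD// frac_intZ.
have -> : frac_int b f = fun v => frac_int b p v + (-1) * frac_int b n v.
  by apply/funext => v; exact: E.
have cbp := continuous_frac_int b0 cp; have cbn := continuous_frac_int b0 cn.
rewrite frac_intD ?frac_intZ//; last by move=> s; apply: cvgMr; exact: cbn.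
by rewrite !frac_int_semigroup_ge0// E ?addr_gt0.
Qed.

Lemma frac_int1 f u : continuous f -> frac_int 1 f u = \int[mu]_(s in `[0, u]) f s.
Proof.
move=> cf; rewrite /frac_int /Rintegral; congr fine.
rewrite -[LHS]integral_itv_bndo_bndc; last first.
  apply: (@measurable_funS _ _ _ _ `[0, u]%classic) => //.
    exact: subset_itv_co_cc.
  exact: measurable_int (integrable_frac_int u ltr01 cf).
rewrite -[RHS]integral_itv_bndo_bndc; last first.
  apply/measurable_EFinP; apply: (@measurable_funS _ _ _ _ setT) => //.
  exact: continuous_measurable_fun.
apply: eq_integral => s; rewrite inE/= in_itv/= => /andP[_ su].
by rewrite frac_kernel1 subr_gt0 su mul1r.
Qed.

End frac_int_theory.

(** * Fractional integral of the exponential *)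

Section frac_int_exp.
Context {R : realType}.
Implicit Types (f g : R -> R) (a b u : R).

Lemma continuous_sum_nat (F : nat -> R -> R) n :
  (forall k, continuous (F k)) -> continuous (fun s => \sum_(0 <= k < n) F k s).
Proof.
move=> cF; elim: n => [|n IH] s.
  rewrite [X in continuous_at s X](_ : _ = cst 0); first exact: cvg_cst.
  by apply/funext => x; rewrite big_nil.
rewrite [X in continuous_at s X](_ : _ = fun s => \sum_(0 <= k < n) F k s + F n s).
  by apply: cvgD; [exact: IH|exact: cF].
by apply/funext => x; rewrite big_nat_recr.
Qed.

Lemma frac_int_sum a (F : nat -> R -> R) n u : 0 < a ->
  (forall k, continuous (F k)) ->
  frac_int a (fun s => \sum_(0 <= k < n) F k s) u =
  \sum_(0 <= k < n) frac_int a (F k) u.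
Proof.
move=> a0 cF; elim: n => [|n IH].
  rewrite big_nil -[RHS](mul0r (frac_kernel (a + 1) u)) -frac_int_cst//.
  by congr frac_int; apply/funext => s; rewrite big_nil.
rewrite big_nat_recr//= -IH -frac_intD//; last exact: continuous_sum_nat.
by congr frac_int; apply/funext => s; rewrite big_nat_recr.
Qed.

Lemma series_exp_coeff_le (x : R) n : 0 <= x -> series (exp_coeff x) n <= expR x.
Proof.
move=> x0; apply: nondecreasing_cvgn_le; last exact: is_cvg_series_exp_coeff.
by apply: nondecreasing_series => k _ _; exact: exp_coeff_ge0.
Qed.

Lemma continuous_expRM (l : R) : continuous (fun s : R => expR (l * s)).
Proof.
by move=> s; apply: continuous_comp; [exact: mulrl_continuous|exact: continuous_expR].
Qed.

(** Termwise integration of the exponential series: [s^k / k!] becomes [u^(a+k) / Gamma (a+k+1)].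
    The partial sums are dominated by [exp (|l| * s)]. *)
Lemma frac_int_exp a l u : 0 < a -> 0 < u ->
  frac_int a (fun s => expR (l * s)) u = u `^ a * MittagLeffler 1 (a + 1) (l * u).
Proof.
move=> a0 u0.
pose F (k : nat) (s : R) := l ^+ k * (s ^+ k / k`!%:R).
have cX (k : nat) : continuous (fun s : R => s ^+ k / k`!%:R).
  by move=> s; apply: cvgMl; exact: exprn_continuous.
have cF k : continuous (F k) by move=> s; apply: cvgMr; exact: cX.
have sE n s : \sum_(0 <= k < n) F k s = series (exp_coeff (l * s)) n.
  by apply: eq_bigr => k _; rewrite /F /exp_coeff/= exprMn mulrA.
have cS n : continuous (fun s => \sum_(0 <= k < n) F k s).
  exact: continuous_sum_nat.
have fE n : frac_int a (fun s => \sum_(0 <= k < n) F k s) u =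
    u `^ a * series (fun k : nat => (l * u) ^+ k / Gamma (1 * k%:R + (a + 1))) n.
  rewrite frac_int_sum// /series/= big_distrr/=; apply: eq_bigr => k _.
  rewrite frac_intZ// frac_int_pow// /frac_kernel u0 exprMn.
  have -> : 1 * k%:R + (a + 1) = a + k.+1%:R by rewrite -natr1; ring.
  have -> : a + k.+1%:R - 1 = a + k%:R by rewrite -natr1; ring.
  rewrite powRD ?(gt_eqF u0) ?implybT// powR_mulrn ?ltW//; ring.
have DC := @dominated_convergence _ _ R mu `[0, u]%classic
  (measurable_itv _)
  (fun n s => (frac_kernel a (u - s) * \sum_(0 <= k < n) F k s)%:E)
  (fun s => (frac_kernel a (u - s) * expR (l * s))%:E)
  (fun s => (frac_kernel a (u - s) * expR (`|l| * s))%:E)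
  (fun n => measurable_int mu (integrable_frac_int u a0 (cS n)))
  (measurable_int mu (integrable_frac_int u a0 (@continuous_expRM l))).
have cvg_s s : \sum_(0 <= k < n) F k s @[n --> \oo] --> expR (l * s).
  rewrite (_ : (fun n => _) = series (exp_coeff (l * s))).
    exact: is_cvg_series_exp_coeff.
  by apply/funext => n; rewrite sE.
have [] := DC _ (integrable_frac_int u a0 (@continuous_expRM `|l|)) _.
- apply/aeW => s _; apply: cvg_EFin; first exact: nearW.
  by apply: cvgMr; exact: cvg_s.
- apply/aeW => s n /=; rewrite in_itv/= => /andP[s0 _].
  rewrite lee_fin normrM ger0_norm ?frac_kernel_ge0// ler_wpM2l ?frac_kernel_ge0//.
  rewrite sE (le_trans (ler_norm_sum _ _ _))//.
  rewrite (le_trans _ (@series_exp_coeff_le (`|l| * s) n _)) ?mulr_ge0//.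
  apply: ler_sum => k _; rewrite /exp_coeff /= normrM normrX normrM.
  by rewrite (ger0_norm s0) [X in _ * X <= _]ger0_norm ?invr_ge0.
move=> _ _ C.
have C2 : frac_int a (fun s => \sum_(0 <= k < n) F k s) u @[n --> \oo] -->
    frac_int a (fun s => expR (l * s)) u.
  apply: fine_cvg; rewrite /frac_int /Rintegral fineK//.
  apply: integrable_fin_num => //; apply: integrable_frac_int => //.
  exact: continuous_expRM.
(* [MittagLeffler] is a [limn], so its series must be shown to converge; this follows from the
   convergence of the integrals, without estimates on Gamma. *)
have C3 : series (fun k : nat => (l * u) ^+ k / Gamma (1 * k%:R + (a + 1))) n @[n --> \oo]
    --> (u `^ a)^-1 * frac_int a (fun s => expR (l * s)) u.
  rewrite (_ : series _ = fun n => (u `^ a)^-1 *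
      frac_int a (fun s => \sum_(0 <= k < n) F k s) u); first exact: cvgMr.
  by apply/funext => n; rewrite fE mulKf// gt_eqF ?powR_gt0.
by rewrite /MittagLeffler (cvg_lim _ C3)// mulVKf// gt_eqF ?powR_gt0.
Qed.

Lemma frac_int_exp_gt0 a l u : 0 < a -> 0 < u ->
  0 < frac_int a (fun s => expR (l * s)) u.
Proof.
move=> a0 u0.
apply: (@lt_le_trans _ _ (frac_int a (fun=> expR (- (`|l| * u))) u)).
  by rewrite frac_int_cst// mulr_gt0 ?expR_gt0// /frac_kernel u0
    divr_gt0 ?powR_gt0 ?Gamma_gt0 ?addr_gt0.
apply: le_frac_int => //; [by move=> s; exact: cvg_cst|exact: continuous_expRM|].
move=> s; rewrite in_itv/= => /andP[s0 su]; rewrite ler_expR lerNl.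
by rewrite (le_trans (ler_norm _))// normrN normrM (ger0_norm s0) ler_wpM2l.
Qed.

End frac_int_exp.

(** * Positivity and the mean value property *)

Lemma derivable_is_derive1 (R : realType) (f : R -> R) (x : R) :
  derivable f x 1 -> is_derive x 1 f (derive1 f x).
Proof. by move=> dfx; apply: DeriveDef; [exact: dfx|rewrite derive1E]. Qed.

Section positivity.
Context {R : realType}.
Implicit Types (f g : R -> R) (a b u : R).

Lemma frac_int_at0 a f : 0 < a -> frac_int a f 0 = 0.
Proof.
by move=> a0; rewrite /frac_int set_itv1 Rintegral_set1.
Qed.

(** The value is [u^a / Gamma (a + 1) * ((1 - a) / (a + 1))], positive because [a < 1]. The line
    vanishes at [u / 2] and equals 1 at [u], which suits it to bounding increasing functions from
    below. *)
Lemma frac_int_linear_gt0 a u : 0 < a < 1 -> 0 < u ->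
  0 < frac_int a (fun s => 2 / u * s - 1) u.
Proof.
move=> /andP[a0 a1] u0.
have E : (fun s : R => 2 / u * s - 1) =
    (fun s => 2 / u * (s ^+ 1 / 1`!%:R) + (- 1)).
  by apply/funext => s; rewrite expr1 divr1.
have c1 : continuous (fun s : R => s ^+ 1 / 1`!%:R).
  by move=> s; apply: cvgMl; exact: exprn_continuous.
rewrite E frac_intD//; first last.
- by move=> s; exact: cvg_cst.
- by move=> s; apply: cvgMr; exact: c1.
rewrite frac_intZ// frac_int_pow// frac_int_cst// /frac_kernel u0.
have -> : a + 2 = (a + 1) + 1 by ring.
have a10 : 0 < a + 1 by rewrite addr_gt0.
rewrite (GammaS a10) !addrK.
rewrite powRD ?(gt_eqF u0) ?implybT// powRr1 ?ltW//.
have P := powR_gt0 a u0; have G := Gamma_gt0 a10.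
have -> : 2 / u * (u `^ a * u / ((a + 1) * Gamma (a + 1))) +
   -1 * (u `^ a / Gamma (a + 1)) =
   u `^ a / Gamma (a + 1) * ((1 - a) / (a + 1)).
  by field; rewrite !gt_eqF.
by rewrite mulr_gt0 ?divr_gt0// subr_gt0.
Qed.

(* If [f X <= 0], then [N := frac_int a K], a primitive of [f], would not be
   increasing at [X], whereas [N T <= (T / X) `^ a * N X] for [T <= X]. *)
Lemma frac_int_increasing_gt0 a f X : 0 < a < 1 -> 0 < X -> continuous f ->
  {in `[0, X] &, {homo frac_int (1 - a) f : s t / s < t}} -> 0 < f X.
Proof.
move=> a01 X0 cf; have /andP[a0 a1] := a01; have b0 : 0 < 1 - a by rewrite subr_gt0.
set K := frac_int (1 - a) f => Kincr.
have cK : continuous K by exact: continuous_frac_int.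
have K0 : K 0 = 0 by exact: frac_int_at0.
have KE : K = frac_int (1 - a) f by [].
clearbody K.
have Kle s t : 0 <= s -> s <= t -> t <= X -> K s <= K t.
  move=> s0; rewrite le_eqVlt => /predU1P[->//|st] tX.
  by apply/ltW/Kincr; rewrite // in_itv/= ?s0 ?tX ?(le_trans s0 (ltW st)) ?(le_trans (ltW st)).
have KX2 : 0 < K (X / 2).
  by rewrite -K0; apply: Kincr; rewrite ?in_itv/=; clear - X0; lra.
pose N := frac_int a K.
have NK u : N u = frac_int a K u by [].
clearbody N.
have NE u : N u = \int[mu]_(s in `[0, u]) f s.
  by rewrite NK KE frac_int_semigroup// addrC subrK frac_int1.
(* [K] dominates [K (X / 2)] times the line [2 / X * s - 1]: the line is nonpositive before [X / 2]
   and at most 1 after it. *)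
have NX0 : 0 < N X.
  have h := mulr_gt0 KX2 (frac_int_linear_gt0 a01 X0).
  have cl : continuous (fun s : R => 2 / X * s - 1).
    by move=> s; apply: cvgB; [apply: cvgMr; exact: cvg_id|exact: cvg_cst].
  apply: (lt_le_trans h); rewrite NK -frac_intZ//.
  have clK : continuous (fun s : R => K (X / 2) * (2 / X * s - 1)).
    by move=> s; apply: cvgMr; exact: cl.
  apply: (le_frac_int a0 clK cK).
  move=> s; rewrite in_itv/= => /andP[s0 sX].
  have [sX2|sX2] := leP (X / 2) s.
    apply: (@le_trans _ _ (K (X / 2))).
      rewrite -[leRHS]mulr1 ler_pM2l// lerBlDr mulrAC ler_pdivrMr//.
      by clear - sX; lra.
    by apply: Kle => //; rewrite divr_ge0 ?ltW.
  apply: (@le_trans _ _ 0); last by rewrite -K0; exact: Kle.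
  by rewrite pmulr_rle0// subr_le0 mulrAC ler_pdivrMr//; clear - sX2; lra.
(* Once scaled, both integrals run over [[0, 1]], where [K (T * s) <= K (X * s)]. *)
have Nle T : 0 <= T -> T <= X -> N T <= T `^ a * (X `^ a)^-1 * N X.
  move=> T0 TX.
  have I_eq (p q i : R) : q != 0 -> p * q^-1 * (q * i) = p * i.
    by move=> q0; rewrite mulrA divfK.
  rewrite !NK (frac_int_scale a0 cK T0) (frac_int_scale a0 cK (ltW X0)).
  have Xa0 : X `^ a != 0 by rewrite gt_eqF// powR_gt0.
  rewrite (I_eq (T `^ a) (X `^ a) _ Xa0).
  apply: ler_wpM2l; first exact: powR_ge0.
  have cKu u : continuous (fun s => K (u * s)).
    by move=> s; apply: continuous_comp; [exact: mulrl_continuous|exact: cK].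
  apply: le_Rintegral.
  - exact: measurable_itv.
  - exact: (integrable_frac_int 1 a0 (cKu T)).
  - exact: (integrable_frac_int 1 a0 (cKu X)).
  move=> s /=; rewrite in_itv/= => /andP[s0 s1].
  apply: ler_wpM2l; first exact: frac_kernel_ge0.
  apply: Kle; [exact: mulr_ge0|exact: ler_wpM2r|].
  by apply: ler_piMr => //; exact: ltW.
have [dN N'] : derivable N X 1 /\ N^`()%classic X = f X.
  have -> : N = fun u => \int[mu]_(s in `[0, u]) f s by apply/funext => u; rewrite NE.
  apply: (@continuous_FTC1_closed _ f 0 X (X + 1)) => //; last exact: cf.
    by rewrite ltrDl.
  apply: continuous_compact_integrable; first exact: segment_compact.
  exact: continuous_subspaceT.
(* By [Nle], [D] is nonnegative on [[0, X]], and it vanishes at [X], so its derivative there,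
   [a / X * N X - f X], is at most 0. Hence [f X] is at least [a / X * N X]. *)
pose D T := T `^ a * ((X `^ a)^-1 * N X) - N T.
have dP := is_derive1_powR a X0.
have dNX : is_derive X 1 N (f X) by apply: DeriveDef; rewrite -?derive1E.
have dD : is_derive X 1 D (a * X `^ (a - 1) * ((X `^ a)^-1 * N X) - f X).
  apply: is_deriveB.
  have := is_deriveM dP (is_derive_cst ((X `^ a)^-1 * N X) X 1).
  by move=> h; apply: (is_derive_eq h); rewrite scaler0 add0r /GRing.scale/= mulrC.
have DX : D X = 0 by rewrite /D mulrA mulfV ?gt_eqF ?powR_gt0// mul1r subrr.
have : a * X `^ (a - 1) * ((X `^ a)^-1 * N X) - f X <= 0.
  case: dD => dD <-.
  have := cvg_dnbhs_at_left dD => C.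
  apply: (ler_cvg_to C (cvg_cst 0)).
  near=> h.
  have h0 : h < 0 by near: h; exact: nbhs_left_lt.
  have hX : - X <= h by near: h; apply: nbhs_left_ge; rewrite oppr_lt0.
  rewrite /= DX subr0 /GRing.scale/= mulr1 nmulr_rle0 ?invr_lt0// /D subr_ge0 mulrA.
  by apply: Nle; clear - hX h0; lra.
rewrite subr_le0; apply: lt_le_trans.
by rewrite !mulr_gt0 ?invr_gt0 ?powR_gt0.
Unshelve. all: by end_near. Qed.

End positivity.

Section mean_value.
Context {R : realType}.
Implicit Types (f w : R -> R) (a l u X : R).

(** Without critical points Rolle makes the continuous function [K] injective, hence strictly
    monotone, with no continuity of its derivative. The decreasing case is the increasing one for
    [- f]. *)
Lemma derive_frac_int_neq0 a f X : 0 < a < 1 -> 0 < X -> continuous f ->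
  {in `]0, X[, forall u, derivable (frac_int (1 - a) f) u 1} ->
  f X = 0 -> exists2 c, c \in `]0, X[ & derive1 (frac_int (1 - a) f) c = 0.
Proof.
move=> a01 X0 cf dK fX0; apply: contrapT => /forall2NP nK.
have K'0 c : c \in `]0, X[ -> derive1 (frac_int (1 - a) f) c != 0.
  by move=> cX; case: (nK c) => // /eqP.
have b0 : 0 < 1 - a by move: a01 => /andP[_]; rewrite subr_gt0.
pose K := frac_int (1 - a) f.
have cK : continuous K by exact: continuous_frac_int.
have neqK x y : x \in `[0, X] -> y \in `[0, X] -> x < y -> K x != K y.
  rewrite !in_itv/= => /andP[x0 _] /andP[_ yX] xy; apply/eqP => Kxy.
  have sub z : z \in `]x, y[ -> z \in `]0, X[.
    by rewrite !in_itv/= => /andP[xz zy]; rewrite (le_lt_trans x0 xz) (lt_le_trans zy).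
  have [||c cxy [_ Kc]] := @Rolle _ K x y xy _ _ Kxy.
  - by move=> z /sub; exact: dK.
  - exact: continuous_subspaceT.
  by have := K'0 c (sub _ cxy); rewrite derive1E Kc eqxx.
have injK : {in `[0, X] &, injective K}.
  move=> x y xX yX Kxy; have [xy|yx|xy] := ltgtP x y; last exact: xy.
    by move: (neqK x y xX yX xy); rewrite Kxy eqxx.
  by move: (neqK y x yX xX yx); rewrite Kxy eqxx.
have [Kincr|Kdecr] := itv_continuous_inj_mono (continuous_subspaceT cK) injK.
  by have := frac_int_increasing_gt0 a01 X0 cf Kincr; rewrite fX0 ltxx.
have cNf : continuous (fun s => -1 * f s) by move=> s; apply: cvgMr; exact: cf.
have KN x : frac_int (1 - a) (fun s => -1 * f s) x = - K x.
  by rewrite (frac_intZ (-1) x b0 cf) mulN1r.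
have Nincr : {in `[0, X] &, {homo frac_int (1 - a) (fun s => -1 * f s) : x y / x < y}}.
  move=> x y xX yX xy; rewrite (KN x) (KN y) ltrN2; exact: Kdecr.
have := frac_int_increasing_gt0 a01 X0 cNf Nincr.
by rewrite fX0 mulr0 ltxx.
Qed.

(* With [m] the claimed value, [w - m * phi] vanishes at [X], where
   [phi := frac_int a (fun s => expR (l * s))] satisfies
   [frac_int (1 - a) phi u = \int_0^u expR (l * s)]. *)
Lemma frac_int_mean_value a l w X : 0 < a < 1 -> 0 < X -> continuous w ->
  {in `]0, X[, forall u, derivable (frac_int (1 - a) w) u 1} ->
  exists2 c, c \in `]0, X[ &
    expR (- l * c) * derive1 (frac_int (1 - a) w) c =
    w X / frac_int a (fun s => expR (l * s)) X.
Proof.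
move=> a01 X0 cw dw; have /andP[a0 a1] := a01.
have b0 : 0 < 1 - a by rewrite subr_gt0.
pose e s : R := expR (l * s); have ce : continuous e := @continuous_expRM _ l.
pose phi := frac_int a e; have cphi : continuous phi by exact: continuous_frac_int.
pose m := w X / phi X.
have phi0 : phi X != 0 by rewrite gt_eqF// frac_int_exp_gt0.
pose r s := w s + - m * phi s.
have cmphi : continuous (fun s => - m * phi s) by move=> s; apply: cvgMr; exact: cphi.
have cr : continuous r by move=> s; apply: cvgD; [exact: cw|exact: cmphi].
have KE : frac_int (1 - a) r =
    fun u => frac_int (1 - a) w u + - m * \int[mu]_(s in `[0, u]) e s.
  apply/funext => u; rewrite frac_intD// frac_intZ// /phi frac_int_semigroup//.
  by rewrite subrK frac_int1.
have dE u : 0 < u -> is_derive u 1 (fun u => \int[mu]_(s in `[0, u]) e s) (e u).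
  move=> u0; have uu1 : u < u + 1 by rewrite ltrDl.
  have ie : mu.-integrable `[0, u + 1] (EFin \o e).
    apply: continuous_compact_integrable; first exact: segment_compact.
    exact: continuous_subspaceT.
  have [d1 d2] := continuous_FTC1_closed uu1 ie u0 (ce u).
  by apply: DeriveDef; rewrite -?derive1E.
have dr u : u \in `]0, X[ -> is_derive u 1 (frac_int (1 - a) r)
    (derive1 (frac_int (1 - a) w) u - m * e u).
  move=> uX; have du := dw u uX; rewrite KE.
  have d1 := derivable_is_derive1 du.
  have u0 : 0 < u by move: uX; rewrite in_itv/= => /andP[].
  have h := is_deriveD d1 (is_deriveZ (- m) (dE u u0)).
  by apply: (is_derive_eq h); rewrite /GRing.scale/= mulNr.
have dK u : u \in `]0, X[ -> derivable (frac_int (1 - a) r) u 1.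
  by move=> /dr [].
have rX0 : r X = 0 by rewrite /r /m mulNr divfK// subrr.
have [c cX rc] := derive_frac_int_neq0 a01 X0 cr dK rX0.
exists c => //.
have := dr c cX => -[_]; rewrite -derive1E rc => /esym/eqP; rewrite subr_eq0 => /eqP ->.
by rewrite mulrCA -expRD mulNr addNr expR0 mulr1.
Qed.

End mean_value.

(** * Differentiability of fractional integrals *)

Section derivable_frac_int.
Context {R : realType}.
Implicit Types (f g : R -> R) (a b p u : R).

Lemma is_derive_frac_kernel a (x : R) : 0 < x ->
  is_derive x 1 (frac_kernel a) ((a - 1) * x `^ (a - 1 - 1) / Gamma a).
Proof.
move=> x0; have dP := is_derive1_powR (a - 1) x0.
have dC := is_deriveM dP (is_derive_cst (Gamma a)^-1 x 1).
have {}dC : is_derive x 1 (fun z : R => z `^ (a - 1) / Gamma a)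
    ((a - 1) * x `^ (a - 1 - 1) / Gamma a).
  by apply: (is_derive_eq dC); rewrite scaler0 add0r /GRing.scale/= mulrC.
apply: near_eq_is_derive dC.
by near=> z; rewrite /frac_kernel ifT//; near: z; exact: lt_nbhsr.
Unshelve. all: by end_near. Qed.

Let is_derive_frac_kernel_sub a (s u c : R) : s < u ->
  is_derive u 1 (fun u => frac_kernel a (u - s) * c)
    ((a - 1) * (u - s) `^ (a - 1 - 1) / Gamma a * c).
Proof.
move=> su; have us0 : 0 < u - s by rewrite subr_gt0.
have d1 : is_derive u 1 (fun u => u - s) 1.
  have := is_deriveB (is_derive_id u 1) (is_derive_cst s u 1).
  by move=> h; apply: (is_derive_eq h); rewrite subr0.
have d2 := @is_derive1_comp _ (frac_kernel a) (fun u => u - s) u _ _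
  (is_derive_frac_kernel a us0) d1.
have dC := is_deriveM d2 (is_derive_cst c u 1).
by apply: (is_derive_eq dC); rewrite scaler0 add0r /GRing.scale/= mulr1 mulrC.
Qed.

Lemma derivable_frac_int_far a f p u : 0 < a < 1 -> continuous f -> 0 <= p < u ->
  derivable (fun v => \int[mu]_(s in `[0, p]) (frac_kernel a (v - s) * f s)) u 1.
Proof.
move=> /andP[a0 a1] cf /andP[p0 pu].
have [M M0 fM] := continuous_bounded_itv 0 p cf.
(* For [v] near [u], [v - s >= m] on [[0, p]]. The derivative of the kernel has absolute value
   [(1 - a) * (v - s)^(a-2) / Gamma a], decreasing in [v - s], whence [B]. *)
pose m := (u - p) / 2; have m0 : 0 < m by rewrite divr_gt0// subr_gt0.
pose B := (1 - a) * m `^ (a - 1 - 1) / Gamma a * M.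
have B0 : 0 <= B.
  rewrite /B !mulr_ge0 ?powR_ge0// ?invr_ge0 ?(ltW (Gamma_gt0 a0)) ?ltW//; lra.
have up v : `]p + m, u + 1[%classic v -> m <= v - p.
  by rewrite /= in_itv/= => /andP[h _]; rewrite lerBrDl ltW.
apply: (@derivable_under_integral _ _ _ mu (fun v s => frac_kernel a (v - s) * f s)
  `[0, p]%classic _ u (p + m) (u + 1) _ _ _ (cst B)) => //.
- rewrite /= in_itv/= ltrDl ltr01 andbT /m; lra.
- move=> v /up mv; apply: (@integrableS _ _ _ mu `[0, v]%classic) => //.
    by apply: subset_itvl; rewrite bnd_simp -subr_ge0 (le_trans (ltW m0)).
  exact: integrable_frac_int.
- move=> v s /up mv; rewrite /= in_itv/= => /andP[s0 sp].
  by have sv : s < v; [lra|case: (is_derive_frac_kernel_sub a (f s) sv)].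
- apply: continuous_compact_integrable; first exact: segment_compact.
  by apply: continuous_subspaceT => s; exact: cvg_cst.
- move=> v s /up mv; rewrite /= in_itv/= => /andP[s0 sp].
  have sv : s < v by lra.
  have vs0 : 0 < v - s by lra.
  rewrite partial1of2E.
  have -> := @derive_val _ _ _ _ _ _ _ (is_derive_frac_kernel_sub a (f s) sv).
  rewrite /B normrM ler_pM ?fM ?in_itv/= ?s0//.
  rewrite normrM normfV (gtr0_norm (Gamma_gt0 a0)) ler_wpM2r ?invr_ge0 ?(ltW (Gamma_gt0 a0))//.
  rewrite normrM ltr0_norm ?subr_lt0// opprB (ger0_norm (powR_ge0 _ _)).
  rewrite ler_wpM2l ?subr_ge0 ?(ltW a1)//.
  have -> : a - 1 - 1 = - (2 - a) by ring.
  rewrite !powRN lef_pV2 ?posrE ?powR_gt0//.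
  apply: ge0_ler_powR; rewrite ?nnegrE; lra.
Qed.

(** In the scaled form the derivative in [u] falls on [g] instead of the singular kernel, and the
    kernel times [M] dominates. *)
Lemma derivable_frac_int_scaled a g v q M : 0 < a -> continuous g -> 0 < v < q ->
  {in `[0, q], forall w, derivable g w 1} ->
  {in `[0, q], forall w, `|derive1 g w| <= M} ->
  derivable (fun u => \int[mu]_(s in `[0, 1]) (frac_kernel a (1 - s) * g (u * s))) v 1.
Proof.
move=> a0 cg /andP[v0 vq] dg gM.
have q0 := lt_trans v0 vq.
have M0 : 0 <= M by rewrite (le_trans _ (gM 0 _))// in_itv/= lexx ltW.
have inq u s : `]0, q[%classic u -> `[0, 1]%classic s -> u * s \in `[0, q].
  rewrite /= !in_itv/= => /andP[u0 uq] /andP[s0 s1]; rewrite mulr_ge0 ?(ltW u0)//=.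
  by rewrite -[leRHS]mulr1 ler_pM ?(ltW u0) ?(ltW uq).
have D u s : `]0, q[%classic u -> `[0, 1]%classic s ->
    is_derive u 1 (fun u => frac_kernel a (1 - s) * g (u * s))
      (frac_kernel a (1 - s) * (derive1 g (u * s) * s)).
  move=> uq s1; have gd := dg _ (inq _ _ uq s1).
  have d0 := derivable_is_derive1 gd.
  have d1 : is_derive u 1 (fun u => u * s) s.
    have := is_deriveM (is_derive_id u 1) (is_derive_cst s u 1).
    by move=> h; apply: (is_derive_eq h); rewrite scaler0 add0r /GRing.scale/= mulr1.
  exact: (is_deriveZ _ (@is_derive1_comp _ g (fun u => u * s) u _ _ d0 d1)).
have cgu u : continuous (fun s => g (u * s)).
  by move=> s; apply: continuous_comp; [exact: mulrl_continuous|exact: cg].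
apply: (@derivable_under_integral _ _ _ mu (fun u s => frac_kernel a (1 - s) * g (u * s))
  `[0, 1]%classic _ v 0 q _ _ _ (fun s => frac_kernel a (1 - s) * M)) => //.
- by rewrite /= in_itv/= v0.
- by move=> u _; exact: integrable_frac_int.
- by move=> u s uq s1; case: (D u s uq s1).
- by move=> s; rewrite mulr_ge0 ?frac_kernel_ge0.
- by apply: (@integrable_frac_int _ _ (cst M)) => // s; exact: cvg_cst.
- move=> u s uq s1; rewrite partial1of2E.
  have -> := @derive_val _ _ _ _ _ _ _ (D u s uq s1).
  rewrite normrM ger0_norm ?frac_kernel_ge0// ler_wpM2l ?frac_kernel_ge0//.
  rewrite normrM -[leRHS]mulr1 ler_pM ?gM ?inq//.
  by move: s1; rewrite /= in_itv/= => /andP[s0 s1]; rewrite ger0_norm.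
Qed.

(* Splitting the integral at [p = u / 2] separates the singularity of the kernel
   at [s = u] from the possible singularity of the derivative of [f] at [0]. *)
Lemma derivable_frac_int a f X u : 0 < a < 1 -> continuous f ->
  {in `]0, X[, forall v, derivable f v 1} -> {in `]0, X[, continuous (derive1 f)} ->
  0 < u < X -> derivable (frac_int a f) u 1.
Proof.
move=> a01 cf df cf' /andP[u0 uX]; have /andP[a0 a1] := a01.
(* [p + q] is the midpoint of [u] and [X]: then [u - p] lies inside []0, q[], while [[p, p + q]] is
   compact in []0, X[], so that [derive1 f] is bounded on it. *)
pose p := u / 2; pose q := (X - u) / 2 + (u - p).
have p0 : 0 < p by rewrite divr_gt0.
have pu : p < u by rewrite /p; lra.
pose g s := f (s + p).
have cg : continuous g.
  by move=> s; apply: continuous_comp; [apply: cvgD; [exact: cvg_id|exact: cvg_cst]|exact: cf].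
have inX w : w \in `[0, q] -> w + p \in `]0, X[.
  rewrite !in_itv/= => /andP[w0 wq]; apply/andP; split; rewrite /q in wq *; lra.
have dg w : w \in `[0, q] -> is_derive w 1 g (derive1 f (w + p)).
  move=> wq; have fd := df _ (inX _ wq).
  have d0 := derivable_is_derive1 fd.
  have d1 : is_derive w 1 (fun w => w + p) 1.
    have := is_deriveD (is_derive_id w 1) (is_derive_cst p w 1).
    by move=> h; apply: (is_derive_eq h); rewrite addr0.
  have := @is_derive1_comp _ f (fun w => w + p) w _ _ d0 d1.
  by move=> h; apply: (is_derive_eq h); rewrite mulr1.
have cf'p : {within `[p, q + p], continuous (derive1 f)}.
  apply: continuous_in_subspaceT => w; rewrite inE /= => wpq; apply: cf'.
  move: wpq; rewrite /q !in_itv/= => /andP[h1 h2]; apply/andP; split; lra.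
have [M M0 fM] := within_continuous_bounded_itv cf'p.
pose G v := \int[mu]_(s in `[0, p]) (frac_kernel a (v - s) * f s).
pose H v := \int[mu]_(s in `[0, 1]) (frac_kernel a (1 - s) * g (v * s)).
(* The part over [[p, v]], translated by [p], is the fractional integral of [g] at [v - p], which is
   then scaled. *)
have E v : p < v -> frac_int a f v = G v + (v - p) `^ a * H (v - p).
  move=> pv; rewrite -frac_int_scale ?subr_ge0 ?ltW//.
  have fi := integrable_frac_int v a0 cf.
  have := @Rintegral_itvB _ (fun s => frac_kernel a (v - s) * f s) (BLeft 0) (BRight v) p fi.
  rewrite !bnd_simp => /(_ (ltW p0) (ltW pv)) /eqP; rewrite subr_eq => /eqP E1.
  rewrite /frac_int E1 addrC; congr (_ + _).
  have fi' : mu.-integrable `]p, v] (EFin \o (fun s => frac_kernel a (v - s) * f s)).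
    apply: integrableS fi => //; apply: subset_itvr; rewrite bnd_simp; exact: ltW.
  rewrite Rintegral_itv_obnd_cbnd//.
  have fi2 : mu.-integrable `[p, v] (EFin \o (fun s => frac_kernel a (v - s) * f s)).
    apply: integrableS fi => //; apply: subset_itvr; rewrite bnd_simp; exact: ltW.
  have := @Rintegral_affine_itv _ (fun s => frac_kernel a (v - s) * f s) 1 p 0 (v - p) ltr01.
  rewrite mulr0 add0r mul1r subrK => /(_ fi2) [_ ->]; rewrite mul1r.
  by apply: eq_Rintegral => s _; rewrite mul1r /g; congr (frac_kernel _ _ * _); ring.
apply: (@near_eq_derivable _ _ _ (fun v => G v + (v - p) `^ a * H (v - p))).
  by near=> v; rewrite E//; near: v; exact: lt_nbhsr.
have d1 : is_derive u 1 (fun u => u - p) 1.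
  have := is_deriveB (is_derive_id u 1) (is_derive_cst p u 1).
  by move=> h; apply: (is_derive_eq h); rewrite subr0.
have up0 : 0 < u - p by rewrite subr_gt0.
apply: derivableD; first by apply: derivable_frac_int_far; rewrite ?a01// ltW.
apply: derivableM.
  by case: (@is_derive1_comp _ (fun z : R => z `^ a) (fun u => u - p) u _ _
    (is_derive1_powR a up0) d1).
have dH : derivable H (u - p) 1.
  apply: (@derivable_frac_int_scaled a g (u - p) q M a0 cg).
  - by rewrite up0 /q; clear - uX; lra.
  - by move=> w /dg [].
  - move=> w wq; rewrite derive1E (@derive_val _ _ _ _ _ _ _ (dg w wq)) fM//.
    by move: wq; rewrite !in_itv/= => /andP[h1 h2]; apply/andP; split; lra.
have d0 := derivable_is_derive1 dH.
by case: (@is_derive1_comp _ H (fun u => u - p) u _ _ d0 d1).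
Unshelve. all: by end_near. Qed.

End derivable_frac_int.

(** * Monotone substitution with integrable singularities *)

Section substitution.
Context {R : realType}.
Variables (U : R -> R) (p q : R).
Hypotheses (pq : p < q) (cU : {within `[p, q], continuous U}).
Hypothesis Uincr : {in `[p, q] &, {homo U : x y / x < y}}.
Hypothesis dU : {in `]p, q[, forall s, derivable U s 1}.
Hypothesis cU' : {in `]p, q[, continuous (derive1 U)}.

(** [n.+3] gives [2 * e n < q - p] for every [n], so the exhausting intervals [[p + e n, q - e n]]
    are never degenerate. *)
Let e (n : nat) : R := (q - p) / n.+3%:R.

Let e_gt0 n : 0 < e n. Proof. by rewrite divr_gt0// subr_gt0. Qed.

Let e_cvg0 : e n @[n --> \oo] --> (0 : R).
Proof.
rewrite -(mulr0 (q - p)); apply: cvgMr.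
rewrite (cvg_shiftS (fun n => n.+2%:R^-1 : R)) (cvg_shiftS (@harmonic R)).
exact: cvg_harmonic.
Qed.

Let e_le m n : (m <= n)%N -> e n <= e m.
Proof. by move=> mn; rewrite ler_pM2l ?subr_gt0// lef_pV2 ?posrE// ler_nat !ltnS. Qed.

Let e_lt n : p + e n < q - e n.
Proof.
rewrite -subr_gt0.
have -> : q - e n - (p + e n) = (q - p) * (1 - 2 / n.+3%:R) by rewrite /e; ring.
by rewrite mulr_gt0 ?subr_gt0// ltr_pdivrMr// mul1r ltr_nat.
Qed.

Let sub_oo n : {subset `[p + e n, q - e n] <= `]p, q[}.
Proof.
move=> s; have := e_gt0 n; rewrite !in_itv/= => e0 /andP[h1 h2].
by apply/andP; split; [rewrite (lt_le_trans _ h1)// ltrDl|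
  rewrite (le_lt_trans h2)// gtrBl].
Qed.

Let in_e n : (p + e n \in `]p, q[) * (q - e n \in `]p, q[).
Proof.
by split; apply: (@sub_oo n); rewrite in_itv/= lexx ?andbT/= ltW// e_lt.
Qed.

Let U_oo s : s \in `]p, q[ -> U s \in `]U p, U q[.
Proof.
move=> spq; have /andP[ps sq] : p < s < q by move: spq; rewrite in_itv.
by rewrite in_itv/= !Uincr// in_itv/= ?lexx ?ltW.
Qed.

Let Ule x y : x \in `]p, q[ -> y \in `]p, q[ -> x <= y -> U x <= U y.
Proof.
move=> /subset_itv_oo_cc xI /subset_itv_oo_cc yI; rewrite le_eqVlt => /predU1P[->//|xy].
exact/ltW/Uincr.
Qed.

Let Ucont s : s \in `]p, q[ -> {for s, continuous U}.
Proof. by move=> /dU h; apply/differentiable_continuous/derivable1_diffP. Qed.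

Let bigcup_itv_e : \bigcup_n `[p + e n, q - e n]%classic = `]p, q[%classic.
Proof.
apply/seteqP; split => [s [n _] /= /sub_oo //|s /=].
rewrite in_itv/= => /andP[ps sq].
near \oo => n; exists n => //=.
have h : e n <= Num.min (s - p) (q - s).
  by near: n; apply: (cvgr_le 0) => //; rewrite lt_min !subr_gt0 ps.
move: h; rewrite le_min in_itv/= => /andP[h1 h2]; apply/andP; split; lra.
Unshelve. all: by end_near. Qed.

Let bigcup_itv_Ue : \bigcup_n `[U (p + e n), U (q - e n)]%classic = `]U p, U q[%classic.
Proof.
apply/seteqP; split => [v [n _] /=|v /=].
  rewrite !in_itv/= => /andP[h1 h2].
  have := U_oo (in_e n).1; have := U_oo (in_e n).2.
  rewrite !in_itv/= => /andP[_ h3] /andP[h4 _].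
  by rewrite (lt_le_trans h4)// (le_lt_trans h2).
rewrite in_itv/= => /andP[pv vq].
have /IVT : {within `[p, q], continuous U} by [].
move=> /(_ v (ltW pq)) []; first by rewrite ge_min le_max (ltW pv) (ltW vq) orbT.
move=> s; rewrite in_itv/= => /andP[ps sq] Us.
have spq : s \in `]p, q[.
  rewrite in_itv/= !lt_neqAle ps sq !andbT; apply/andP; split; apply/eqP => E.
    by move: pv; rewrite -Us -E ltxx.
  by move: vq; rewrite -Us E ltxx.
have : `]p, q[%classic s by [].
rewrite -bigcup_itv_e => -[n _] /= sn; exists n => //=.
rewrite -Us in_itv/=; move: (sn); rewrite in_itv/= => /andP[h1 h2].
by rewrite !Ule ?(in_e n).
Qed.

Section integrand.
Variable G : R -> R.
Hypothesis cG : {in `]U p, U q[, continuous G}.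

Let cGU : {in `]p, q[, continuous (fun s => G (U s) * derive1 U s)}.
Proof.
move=> s spq; apply: cvgM; last exact: cU'.
by apply: continuous_comp; [exact: Ucont|apply: cG; exact: U_oo].
Qed.

Lemma measurable_substitution : measurable_fun (`]p, q[%classic : set R)
  (fun s => G (U s) * derive1 U s).
Proof.
apply: open_continuous_measurable_fun; first exact: interval_open.
by move=> s; rewrite inE => /cGU.
Qed.

Lemma measurable_substituted : measurable_fun (`]U p, U q[%classic : set R) G.
Proof.
apply: open_continuous_measurable_fun; first exact: interval_open.
by move=> s; rewrite inE => /cG.
Qed.

(** [G] and [derive1 U] may be singular at the ends, so substitution is done on the exhausting
    closed intervals, and both sides pass to the limit by monotone convergence. *)
Lemma ge0_substitution_oo : (forall v, 0 <= G v) ->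
  {in `]p, q[, forall s, 0 <= derive1 U s} ->
  (\int[mu]_(s in `]p, q[) (G (U s) * derive1 U s)%:E =
   \int[mu]_(v in `]U p, U q[) (G v)%:E)%E.
Proof.
move=> G0 U'0.
have E n : (\int[mu]_(s in `[(p + e n)%R, (q - e n)%R]) (G (U s) * derive1 U s)%:E =
            \int[mu]_(v in `[U (p + e n)%R, U (q - e n)%R]) (G v)%:E)%E.
  have sub := @sub_oo n.
  have sub' s : s \in `]p + e n, q - e n[ -> s \in `]p, q[.
    by move=> /subset_itv_oo_cc /sub.
  symmetry; apply: (@integration_by_substitution_increasing _ U G).
  - by apply: ltW; exact: e_lt.
  - by move=> x y /sub /subset_itv_oo_cc xI /sub /subset_itv_oo_cc yI; exact: Uincr.
  - by move=> s /sub'; exact: cU'.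
  - apply/cvg_ex; exists (derive1 U (p + e n)); apply: cvg_at_right_filter.
    exact: cU' (in_e n).1.
  - apply/cvg_ex; exists (derive1 U (q - e n)); apply: cvg_at_left_filter.
    exact: cU' (in_e n).2.
  - split; first by move=> s /sub'; exact: dU.
      by apply: cvg_at_right_filter; exact: Ucont (in_e n).1.
    by apply: cvg_at_left_filter; exact: Ucont (in_e n).2.
  - apply: continuous_in_subspaceT => v; rewrite inE/= => vn; apply: cG.
    have : (\bigcup_n `[U (p + e n), U (q - e n)]%classic) v by exists n.
    by rewrite bigcup_itv_Ue.
have C1 : (\int[mu]_(s in `[(p + e n)%R, (q - e n)%R])
    (G (U s) * derive1 U s)%:E)%E @[n --> \oo] --> (\int[mu]_(s in `]p, q[) (G (U s) * derive1 U s)%:E)%E.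
  rewrite -bigcup_itv_e; apply: ge0_nondecreasing_set_cvg_integral.
  - move=> m n mn; rewrite subsetEset; apply: subset_itv; rewrite bnd_simp.
      by rewrite lerD2l e_le.
    by rewrite lerD2l lerN2 e_le.
  - by move=> n; exact: measurable_itv.
  - move=> n; apply/measurable_EFinP.
    apply: (measurable_funS _ _ measurable_substitution) => //.
    exact: sub_oo.
  - by move=> n s /= /sub_oo spq; rewrite lee_fin mulr_ge0// U'0.
have C2 : (\int[mu]_(v in `[U (p + e n)%R, U (q - e n)%R]) (G v)%:E)%E @[n --> \oo]
    --> (\int[mu]_(v in `]U p, U q[) (G v)%:E)%E.
  rewrite -bigcup_itv_Ue; apply: ge0_nondecreasing_set_cvg_integral.
  - move=> m n mn; rewrite subsetEset; apply: subset_itv; rewrite bnd_simp.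
      by apply: Ule; [exact: (in_e n).1|exact: (in_e m).1|rewrite lerD2l; exact: e_le].
    by apply: Ule; [exact: (in_e m).2|exact: (in_e n).2|rewrite lerD2l lerN2; exact: e_le].
  - by move=> n; exact: measurable_itv.
  - move=> n; apply/measurable_EFinP.
    apply: (measurable_funS _ _ measurable_substituted) => //.
    by move=> v vn; rewrite -bigcup_itv_Ue; exists n.
  - by move=> n v _; rewrite lee_fin.
apply: (cvg_unique _ C1); first exact: ereal_hausdorff.
rewrite (_ : (fun n => _) =
  (fun n => (\int[mu]_(v in `[U (p + e n)%R, U (q - e n)%R]) (G v)%:E)%E)) //.
by apply/funext.
Qed.

End integrand.

(** No integrability is required: the integrals of the positive parts agree, and so do those of the
    negative parts, even when infinite. *)
Lemma Rintegral_substitution (G : R -> R) : {in `]U p, U q[, continuous G} ->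
  {in `]p, q[, forall s, 0 <= derive1 U s} ->
  \int[mu]_(s in `[p, q]) (G (U s) * derive1 U s) =
  \int[mu]_(v in `[U p, U q]) G v.
Proof.
move=> cG U'0; rewrite /Rintegral; congr fine.
rewrite integral_itv_bndoo; last first.
  by apply/measurable_EFinP; exact: measurable_substitution.
rewrite [RHS]integral_itv_bndoo; last first.
  by apply/measurable_EFinP; exact: measurable_substituted.
(* [k = 1] gives the positive part and [k = -1] the negative one; the factor [derive1 U] enters the
   maximum because it is nonnegative. *)
have part (H : R -> R) (k : R) : continuous H -> H = (fun x => Num.max (k * x) 0) ->
    (\int[mu]_(s in `]p, q[) (Num.max (k * (G (U s) * derive1 U s)) 0)%:E =
     \int[mu]_(v in `]U p, U q[) (Num.max (k * G v) 0)%:E)%E.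
  move=> cH HE; rewrite -(@ge0_substitution_oo (fun v => Num.max (k * G v) 0))//; first last.
  - by move=> v; rewrite le_max lexx orbT.
  - move=> v vpq; have := continuous_comp (cG v vpq) (cH (G v)).
    by rewrite HE.
  apply: eq_integral => s; rewrite inE/= => spq; congr EFin.
  by rewrite maxr_pMl ?U'0// mul0r mulrA.
have cmax (k : R) : continuous (fun x : R => Num.max (k * x) 0).
  move=> x; apply: (@continuous_max _ _ (fun x : R => k * x) (cst 0)).
    exact: mulrl_continuous.
  exact: cvg_cst.
rewrite [LHS]integralE [RHS]integralE; congr (_ - _)%E.
  have := part _ 1 (cmax 1) erefl => E.
  transitivity (\int[mu]_(s in `]p, q[) (Num.max (1 * (G (U s) * derive1 U s)) 0)%:E)%E.
    by apply: eq_integral => s _; rewrite funeposE mul1r EFin_max.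
  rewrite E; apply: eq_integral => v _; rewrite funeposE mul1r EFin_max//.
have := part _ (-1) (cmax (-1)) erefl => E.
transitivity (\int[mu]_(s in `]p, q[) (Num.max (-1 * (G (U s) * derive1 U s)) 0)%:E)%E.
  by apply: eq_integral => s _; rewrite funenegE mulN1r EFin_max.
by rewrite E; apply: eq_integral => v _; rewrite funenegE mulN1r EFin_max.
Qed.

End substitution.

(** * Reduction of the tempered operators *)

Section tempered.
Context {R : realType}.
Implicit Types (Psi y w : R -> R) (a l : R).

(** The tempering factor splits as [exp (- l * X) * exp (l * (Psi s - Psi 0))]: the first leaves the
    integral, the second is absorbed in [w]. *)
Lemma tempered_integral_frac_int Psi y w a l c : 0 < a < 1 -> 0 < c ->
  {within `[0, c], continuous Psi} ->
  {in `[0, c] &, {homo Psi : s u / s < u}} ->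
  {in `]0, c[, forall s, derivable Psi s 1} ->
  {in `]0, c[, continuous (derive1 Psi)} ->
  {in `]0, c[, forall s, 0 <= derive1 Psi s} ->
  continuous w ->
  {in `[0, c], forall s, w (Psi s - Psi 0) = expR (l * (Psi s - Psi 0)) * y s} ->
  tempered_integral Psi a l y c =
  expR (- l * (Psi c - Psi 0)) * frac_int a w (Psi c - Psi 0).
Proof.
move=> /andP[a0 a1] c0 cP iP dP cP' P'0 cw wE.
set X := Psi c - Psi 0.
pose G v := frac_kernel a (X - (1 * v + - Psi 0)) * w (1 * v + - Psi 0).
pose k := Gamma a * expR (- l * X).
have Ga := Gamma_gt0 a0.
have [iG IG] : mu.-integrable `[Psi 0, Psi c] (EFin \o G) /\
    frac_int a w X = \int[mu]_(v in `[Psi 0, Psi c]) G v.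
  have := integrable_frac_int X a0 cw; rewrite /frac_int.
  have E0 : 0 = 1 * Psi 0 + - Psi 0 by rewrite mul1r subrr.
  have EX : X = 1 * Psi c + - Psi 0 by rewrite mul1r.
  rewrite {1 3}E0 {1 3}EX => h.
  have [h1 h2] := Rintegral_affine_itv ltr01 h.
  by split; [exact: h1|rewrite h2 mul1r].
have cG : {in `]Psi 0, Psi c[, continuous (fun v => k * G v)}.
  move=> v; rewrite in_itv/= => /andP[v0 vc].
  have Xv : 0 < X - (1 * v + - Psi 0) by rewrite /X; clear - vc; lra.
  have ca : continuous (fun v : R => 1 * v + - Psi 0).
    by move=> x; apply: cvgD; [apply: cvgMr; exact: cvg_id|exact: cvg_cst].
  have cfk : {for v, continuous (fun v : R => frac_kernel a (X - (1 * v + - Psi 0)))}.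
    apply: (@continuous_comp _ _ _ (fun v : R => X - (1 * v + - Psi 0)) (frac_kernel a)).
      by apply: cvgB; [exact: cvg_cst|exact: ca].
    apply/differentiable_continuous/derivable1_diffP.
    by case: (is_derive_frac_kernel a Xv).
  have cwk : {for v, continuous (fun v : R => w (1 * v + - Psi 0))}.
    by apply: continuous_comp; [exact: ca|exact: cw].
  by apply: cvgMr; exact: (cvgM cfk cwk).
have S := Rintegral_substitution c0 cP iP dP cP' cG P'0.
rewrite RintegralZl// in S.
rewrite IG; apply: (mulfI (lt0r_neq0 Ga)).
rewrite [RHS]mulrA -/k -S /tempered_integral mulrA mulfV ?gt_eqF// mul1r.
apply: eq_Rintegral => s; rewrite inE/= => sc.
have sI := sc; rewrite in_itv/= in sc; case/andP: sc => s0 sc.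
have Psc : Psi s <= Psi c.
  move: sc; rewrite le_eqVlt => /predU1P[->//|sc].
  by apply/ltW/iP => //; rewrite in_itv/= ltW//= lexx.
rewrite /G mul1r wE//.
have -> : X - (Psi s - Psi 0) = Psi c - Psi s by rewrite /X; ring.
have eE : expR (- l * (Psi c - Psi s)) = expR (- l * X) * expR (l * (Psi s - Psi 0)).
  by rewrite -expRD /X; congr expR; ring.
rewrite eE /frac_kernel subr_gt0; case: ltgtP Psc => // Psc _.
  by rewrite /k; field; rewrite gt_eqF.
(* At the endpoint the power is the default 0, as [a - 1] is nonzero, and it matches the value of
   [frac_kernel] at 0. *)
by rewrite Psc subrr powR0 ?subr_eq0 ?lt_eqF// !(mul0r, mulr0).
Qed.

(** Extends data given on a segment to the whole line, as the results on [frac_int] ask for global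
    continuity. *)
Lemma continuous_clamp (f : R -> R) (p q : R) : p <= q ->
  {within `[p, q], continuous f} ->
  continuous (fun u : R => f (Num.max p (Num.min q u))).
Proof.
move=> pq cf u.
have ccl : continuous (fun u : R => Num.max p (Num.min q u)).
  move=> x; apply: (@continuous_max _ _ (cst p) (fun x => Num.min q x)).
    exact: cvg_cst.
  by apply: (@continuous_min _ _ (cst q) id); [exact: cvg_cst|exact: cvg_id].
have clI x : `[p, q]%classic (Num.max p (Num.min q x)).
  by rewrite /= in_itv/= le_max lexx/= ge_max pq ge_min lexx.
move/subspace_continuousP : cf => /(_ _ (clI u)) C.
apply: cvg_comp C.
move=> A /= [e e0 eA].
have h : \forall x \near u, ball (Num.max p (Num.min q u)) e (Num.max p (Num.min q x)).
  exact: (ccl u _ (nbhsx_ballx _ _ e0)).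
suff : \forall x \near u, A (Num.max p (Num.min q x)) by [].
by apply: filterS h => x xe; exact: eA (clI x).
Qed.

Lemma tempered_mean_value Psi y a l t : 0 < a < 1 -> 0 < t ->
  {within `[0, t], continuous Psi} ->
  {in `[0, t] &, {homo Psi : s u / s < u}} ->
  {in `]0, t[, forall s, derivable Psi s 1} ->
  {in `]0, t[, continuous (derive1 Psi)} ->
  {in `]0, t[, forall s, 0 < derive1 Psi s} ->
  {within `[0, t], continuous y} ->
  {in `]0, t[, forall s, derivable y s 1} ->
  {in `]0, t[, continuous (derive1 y)} ->
  exists c : R,
    [/\ 0 < c < t,
        derivable (tempered_integral Psi (1 - a) l y) c 1 &
        tempered_RL_derivative Psi a l y c =
        (expR (l * (Psi t - Psi 0)) * y t
         - (Psi t - Psi 0) `^ (a - 1) / Gamma a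
           * value_at_0 (RL_integral Psi (1 - a)
               (fun s => expR (l * (Psi s - Psi 0)) * y s)))
        / ((Psi t - Psi 0) `^ a
           * MittagLeffler 1 (a + 1) (l * (Psi t - Psi 0)))].
Proof.
move=> a01 t0 cP iP dP cP' P'0 cy dy cy'; have /andP[a0 a1] := a01.
have b01 : 0 < 1 - a < 1 by apply/andP; split; clear - a0 a1; lra.
have b0 : 0 < 1 - a by case/andP: b01.
have t0' := ltW t0.
have I0 : 0 \in `[0, t] by rewrite in_itv/= lexx.
have It : t \in `[0, t] by rewrite in_itv/= lexx ltW.
pose X := Psi t - Psi 0.
have X0 : 0 < X by rewrite subr_gt0 iP.
have Pinj : {in `[0, t] &, injective Psi}.
  by move=> u v uI vI E; apply/eqP; case: ltgtP => // h;
    [have := iP u v uI vI h|have := iP v u vI uI h]; rewrite E ltxx.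
(* The inverse of [Psi]. The default 0 off its image is harmless: [Vc] below clamps its argument to
   [[Psi 0, Psi t]], where every value is attained. *)
pose V v := xget 0 [set s | s \in `[0, t] /\ Psi s = v].
have VK : {in `[0, t], cancel Psi V}.
  move=> s sI; have [VI VE] := xgetPex 0
    (ex_intro (fun u => u \in `[0, t] /\ Psi u = Psi s) s (conj sI erefl)).
  exact: Pinj.
have cV := segment_can_le_continuous t0' cP VK.
have Pt0 : Psi 0 <= Psi t by rewrite -subr_ge0 ltW.
pose z s := expR (l * (Psi s - Psi 0)) * y s.
have ce : {within `[0, t], continuous (fun s => expR (l * (Psi s - Psi 0)))}.
  apply: (@within_continuous_comp _ _ _ `[0, t]%classic Psi
    (fun v => expR (l * (v - Psi 0)))); last exact: cP.
  move=> v _.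
  apply: continuous_comp; last exact: continuous_expR.
  by apply: cvgMr; apply: cvgB; [exact: cvg_id|exact: cvg_cst].
have cz : {within `[0, t], continuous z}.
  by move=> s; exact: (cvgM (ce s) (cy s)).
have cz' := continuous_clamp t0' cz.
have cV' := continuous_clamp Pt0 cV.
pose zc s := z (Num.max 0 (Num.min t s)).
pose Vc v := V (Num.max (Psi 0) (Num.min (Psi t) v)).
have zcE s : s \in `[0, t] -> zc s = z s.
  by rewrite in_itv/= => /andP[s0 st]; rewrite /zc (min_idPr st) (max_idPr s0).
have VcK s : s \in `[0, t] -> Vc (Psi s) = s.
  move=> sI; have /andP[h1 h2] : Psi 0 <= Psi s <= Psi t.
    move: (sI); rewrite in_itv/= !le_eqVlt => /andP[].
    move=> /predU1P[<-|s0] /predU1P[->|st]; rewrite ?eqxx ?orbT ?andbT//=.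
    - by rewrite !iP// orbT.
    - by rewrite !iP// orbT.
    - by rewrite !iP// !orbT.
  by rewrite /Vc (min_idPr h2) (max_idPr h1) VK.
have czc : continuous zc by exact: cz'.
have cVc : continuous Vc by exact: cV'.
clearbody zc Vc.
pose w u := zc (Vc (Psi 0 + u)).
have cw : continuous w.
  move=> u; apply: (@continuous_comp _ _ _ (fun u => Vc (Psi 0 + u)) zc); last exact: czc.
  apply: (@continuous_comp _ _ _ (fun u => Psi 0 + u) Vc); last exact: cVc.
  by apply: cvgD; [exact: cvg_cst|exact: cvg_id].
have wE s : s \in `[0, t] -> w (Psi s - Psi 0) = z s.
  by move=> sI; rewrite /w addrC subrK VcK// zcE.
have oo_cc s : s \in `]0, t[ -> s \in `[0, t] by exact: subset_itv_oo_cc.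
have Psi_oo s : s \in `]0, t[ -> Psi s - Psi 0 \in `]0, X[.
  move=> st; have sI := oo_cc s st; move: st; rewrite !in_itv/= => /andP[s0 st].
  by rewrite subr_gt0 /X ltrD2r !iP.
have surj u : u \in `]0, X[ -> exists2 s, s \in `]0, t[ & Psi s - Psi 0 = u.
  rewrite in_itv/= => /andP[u0 uX].
  have [|s sI sE] := @IVT _ Psi 0 t (Psi 0 + u) t0' cP.
    rewrite ge_min le_max lerDl (ltW u0)/=; apply/orP; right.
    by rewrite -lerBrDl ltW.
  exists s; last by rewrite sE addrC addKr.
  move: sI sE; rewrite !in_itv/= !le_eqVlt => /andP[/predU1P[<-|s0] /predU1P[->|st]] sE;
    rewrite ?s0 ?st//.
  - by move: X0; rewrite /X sE; lra.
  - by move: u0; lra.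
  - by move: uX; rewrite /X; lra.
pose zd s := expR (l * (Psi s - Psi 0)) * (l * derive1 Psi s) * y s +
  expR (l * (Psi s - Psi 0)) * derive1 y s.
have dPs s : s \in `]0, t[ -> is_derive s 1 Psi (derive1 Psi s).
  by move=> st; exact: derivable_is_derive1 (dP s st).
have dPs0 s : s \in `]0, t[ -> is_derive s 1 (fun u => Psi u - Psi 0) (derive1 Psi s).
  move=> st; have h := is_deriveB (dPs s st) (is_derive_cst (Psi 0) s 1).
  by apply: (is_derive_eq h); rewrite subr0.
have de k s : s \in `]0, t[ -> is_derive s 1 (fun u => expR (k * (Psi u - Psi 0)))
    (expR (k * (Psi s - Psi 0)) * (k * derive1 Psi s)).
  move=> st; have h := is_deriveZ k (dPs0 s st).
  exact: (@is_derive1_comp _ expR (fun u => k * (Psi u - Psi 0)) s _ _ (is_derive_expR _) h).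
have dz s : s \in `]0, t[ -> is_derive s 1 z (zd s).
  move=> st; have dys := derivable_is_derive1 (dy s st).
  have h := is_deriveM (de l s st) dys.
  by apply: (is_derive_eq h); rewrite /GRing.scale/= /zd; ring.
have near_oo s : s \in `]0, t[ -> \forall u \near s, u \in `]0, t[.
  exact: near_in_itvoo.
have dzc s : s \in `]0, t[ -> is_derive s 1 zc (zd s).
  move=> st; apply: near_eq_is_derive (dz s st).
  by apply: filterS (near_oo s st) => u /oo_cc uI; rewrite zcE.
have cPs s : s \in `]0, t[ -> {for s, continuous Psi}.
  by move=> /dPs [h _]; apply/differentiable_continuous/derivable1_diffP.
have dVc s : s \in `]0, t[ -> is_derive (Psi s) 1 Vc (derive1 Psi s)^-1.
  move=> st; apply: (@is_derive_inverse _ Psi Vc).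
  - by apply: filterS (near_oo s st) => u /oo_cc uI; rewrite VcK.
  - by apply: filterS (near_oo s st) => u /cPs.
  - exact: dPs.
  - by rewrite gt_eqF// P'0.
have dw s : s \in `]0, t[ -> is_derive (Psi s - Psi 0) 1 w (zd s / derive1 Psi s).
  move=> st.
  have E : Psi 0 + (Psi s - Psi 0) = Psi s by rewrite addrC subrK.
  have h1 : is_derive (Psi s - Psi 0) 1 (fun u => Psi 0 + u) 1.
    have h := is_deriveD (is_derive_cst (Psi 0) (Psi s - Psi 0) 1)
      (is_derive_id (Psi s - Psi 0) 1).
    by apply: (is_derive_eq h); rewrite add0r.
  have h2 : is_derive (Psi s - Psi 0) 1 (fun u => Vc (Psi 0 + u)) (derive1 Psi s)^-1.
    have dV : is_derive (Psi 0 + (Psi s - Psi 0)) 1 Vc (derive1 Psi s)^-1.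
      by rewrite E; exact: dVc.
    have h := @is_derive1_comp _ Vc (fun u => Psi 0 + u) (Psi s - Psi 0) _ _ dV h1.
    by apply: (is_derive_eq h); rewrite mulr1.
  have dz2 : is_derive (Vc (Psi 0 + (Psi s - Psi 0))) 1 zc (zd s).
    by rewrite E VcK ?oo_cc//; exact: dzc.
  exact: (@is_derive1_comp _ zc (fun u => Vc (Psi 0 + u)) (Psi s - Psi 0) _ _ dz2 h2).
have w'E u : u \in `]0, X[ ->
    derive1 w u = zd (Vc (Psi 0 + u)) / derive1 Psi (Vc (Psi 0 + u)).
  move=> /surj[s st <-]; have [_ dwE] := dw s st; rewrite derive1E dwE.
  by rewrite addrC subrK VcK ?oo_cc.
have dw1 : {in `]0, X[, forall u, derivable w u 1}.
  by move=> u /surj[s st <-]; case: (dw s st).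
have czd s : s \in `]0, t[ -> {for s, continuous (fun s => zd s / derive1 Psi s)}.
  move=> st; have ces : {for s, continuous (fun u => expR (l * (Psi u - Psi 0)))}.
    by case: (de l s st) => h _; apply/differentiable_continuous/derivable1_diffP.
  have cys : {for s, continuous y}.
    by apply/differentiable_continuous/derivable1_diffP; exact: dy.
  apply: cvgM; last by apply: cvgV; [rewrite gt_eqF// P'0|exact: cP'].
  apply: cvgD; last by apply: cvgM; [exact: ces|exact: cy'].
  apply: cvgM; last exact: cys.
  by apply: cvgM; [exact: ces|apply: cvgMr; exact: cP'].
(* Only on the open interval: the quotient by [derive1 Psi] is not controlled at the ends. *)
have cw' : {in `]0, X[, continuous (derive1 w)}.
  move=> u uX; have [s st sE] := surj u uX.
  pose D s := zd s / derive1 Psi s.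
  have VuE : Vc (Psi 0 + u) = s by rewrite -sE addrC subrK VcK ?oo_cc.
  have C : {for u, continuous (fun u => D (Vc (Psi 0 + u)))}.
    apply: (@continuous_comp _ _ _ (fun u => Vc (Psi 0 + u)) D).
      apply: (@continuous_comp _ _ _ (fun u => Psi 0 + u) Vc); last exact: cVc.
      by apply: cvgD; [exact: cvg_cst|exact: cvg_id].
    by rewrite VuE; exact: czd.
  rewrite /continuous_at w'E//; apply: cvg_trans C; apply: near_eq_cvg.
  have nu : \forall v \near u, v \in `]0, X[ by exact: near_in_itvoo.
  by apply: filterS nu => v vX; rewrite w'E.
pose J := frac_int (1 - a) w.
have dJ : {in `]0, X[, forall u, derivable J u 1}.
  by move=> u; rewrite in_itv/= => uX; exact: (derivable_frac_int b01 cw dw1 cw' uX).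
have cJ : continuous J by exact: continuous_frac_int.
have J0 : J 0 = 0 by exact: frac_int_at0.
have [u uX uE] := frac_int_mean_value l a01 X0 cw dJ.
(* Used twice with the same [w]: [k = l], [v = y] for the derivative, and [k = 0], [v = z] for the
   bracket at 0. *)
have tempE k v s :
    {in `[0, t], forall r, w (Psi r - Psi 0) = expR (k * (Psi r - Psi 0)) * v r} ->
    0 < s -> s <= t ->
    tempered_integral Psi (1 - a) k v s = expR (- k * (Psi s - Psi 0)) * J (Psi s - Psi 0).
  move=> wv s0 st.
  have sub r : r \in `[0, s] -> r \in `[0, t].
    by rewrite !in_itv/= => /andP[-> /le_trans]; apply.
  have sub' r : r \in `]0, s[ -> r \in `]0, t[.
    by rewrite !in_itv/= => /andP[-> /lt_le_trans]; apply.
  apply: tempered_integral_frac_int b01 s0 _ _ _ _ _ cw _.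
  - by apply: continuous_subspaceW cP => r; exact: sub.
  - by move=> r1 r2 /sub h1 /sub h2; exact: iP.
  - by move=> r /sub'; exact: dP.
  - by move=> r /sub'; exact: cP'.
  - by move=> r /sub' rt; apply: ltW; exact: P'0.
  - by move=> r /sub; exact: wv.
rewrite -/J in uE; clearbody J.
have TE s : s \in `]0, t[ ->
    tempered_integral Psi (1 - a) l y s = expR (- l * (Psi s - Psi 0)) * J (Psi s - Psi 0).
  by rewrite in_itv/= => /andP[s0 st]; apply: tempE => //; exact: ltW.
(* For small [s > 0] the integral is [J (Psi s - Psi 0)], and [J] is continuous with [J 0 = 0]. *)
have value0 : value_at_0 (RL_integral Psi (1 - a)
    (fun s => expR (l * (Psi s - Psi 0)) * y s)) = 0.
  apply: cvg_lim => //.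
  have cJP : {within `[0, t], continuous (fun s => J (Psi s - Psi 0))}.
    apply: (@within_continuous_comp _ _ _ `[0, t]%classic Psi
      (fun v => J (v - Psi 0))); last exact: cP.
    move=> v _.
    apply: continuous_comp; last exact: cJ.
    by apply: cvgB; [exact: cvg_id|exact: cvg_cst].
  have [_ C _] := (continuous_within_itvP _ t0).1 cJP.
  rewrite subrr J0 in C; apply: cvg_trans C; apply: near_eq_cvg; near=> s.
  rewrite /RL_integral (tempE 0 z); last 3 first.
  - by move=> r rI; rewrite wE// mul0r expR0 mul1r.
  - by near: s; exact: nbhs_right_gt.
  - by near: s; exact: nbhs_right_le.
  by rewrite oppr0 mul0r expR0 mul1r.
have [c ct cE] := surj u uX.
have cX := Psi_oo c ct.
have dJc := derivable_is_derive1 (dJ _ cX).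
have dT : is_derive c 1 (tempered_integral Psi (1 - a) l y)
    (derive1 Psi c * (expR (- l * (Psi c - Psi 0)) * derive1 J (Psi c - Psi 0) -
      l * (expR (- l * (Psi c - Psi 0)) * J (Psi c - Psi 0)))).
  have h1 := @is_derive1_comp _ J (fun s => Psi s - Psi 0) c _ _ dJc (dPs0 c ct).
  have h2 := is_deriveM (de (- l) c ct) h1.
  apply: near_eq_is_derive (is_derive_eq h2 _).
    by apply: filterS (near_oo c ct) => s st; rewrite TE.
  by rewrite /GRing.scale/=; ring.
exists c; split.
- by move: ct; rewrite in_itv.
- by case: dT.
rewrite /tempered_RL_derivative value0 mulr0 subr0.
rewrite [derive1 (tempered_integral _ _ _ _) c]derive1E (@derive_val _ _ _ _ _ _ _ dT).
(* The term produced by differentiating the exponential cancels against the zeroth-order term of the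
   tempered derivative. *)
rewrite mulKf ?gt_eqF ?P'0// TE// subrK cE.
rewrite -frac_int_exp// -/(z t) -wE//.
Unshelve. all: by end_near. Qed.

End tempered.

(** * Regularity on subintervals, strict monotonicity, and the mean value theorem *)

Lemma class_C1_itv (R : realType) (b t : R) (f : R -> R) : 0 < t <= b ->
  class_C 1 0 b f ->
  [/\ {within `[0, t], continuous f}, {in `]0, t[, forall s, derivable f s 1} &
      {in `]0, t[, continuous (derive1 f)}].
Proof.
move=> /andP[t0 tb] [F [<- cF dF]]; have b0 := lt_le_trans t0 tb.
have sub s : s \in `]0, t[ -> s \in `]0, b[.
  by rewrite !in_itv/= => /andP[-> /lt_le_trans]; apply.
split.
- by apply: continuous_subspaceW (cF 0%N isT); exact: subset_itvl.
- by move=> s /sub sb; case: (dF 0%N isT s sb).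
- move=> s st; have [cF1 _ _] := (continuous_within_itvP _ b0).1 (cF 1%N isT).
  (* [derive1] is two-sided, so it is identified with the continuous [F 1] at interior points
     only. *)
  have F1E r : r \in `]0, t[ -> derive1 (F 0%N) r = F 1%N r.
    by move=> /sub rb; rewrite derive1E; case: (dF 0%N isT r rb).
  have C := cF1 s (sub s st).
  rewrite /continuous_at F1E//; apply: cvg_trans C; apply: near_eq_cvg.
  have nu : \forall r \near s, r \in `]0, t[ by exact: near_in_itvoo.
  by apply: filterS nu => r rt; rewrite F1E.
Qed.

(** Two equal values would, by Rolle, create a zero of the derivative between them. *)
Lemma homo_lt_of_derive1_neq0 (R : realType) (f : R -> R) (p q : R) :
  {within `[p, q], continuous f} -> {in `]p, q[, forall s, derivable f s 1} ->
  {in `[p, q] &, {homo f : s u / s <= u}} ->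
  {in `]p, q[, forall s, derive1 f s != 0} ->
  {in `[p, q] &, {homo f : s u / s < u}}.
Proof.
move=> cf df mf f'0 s u sI uI su.
rewrite lt_neqAle mf ?ltW// andbT; apply/eqP => fsu.
have /andP[ps uq] : (p <= s) && (u <= q).
  by move: sI uI; rewrite !in_itv/= => /andP[-> _] /andP[_ ->].
have sub r : r \in `]s, u[ -> r \in `]p, q[.
  by rewrite !in_itv/= => /andP[sr ru]; rewrite (le_lt_trans ps sr) (lt_le_trans ru).
have [||c csu [_ fc]] := @Rolle _ f s u su _ _ fsu.
- by move=> r /sub; exact: df.
- apply: continuous_subspaceW cf => r /=; rewrite !in_itv/= => /andP[sr ru].
  by rewrite (le_trans ps sr) (le_trans ru).
by have := f'0 c (sub c csu); rewrite derive1E fc eqxx.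
Qed.

(** The derivability conjunct, together with [derive1 Psi c != 0], certifies that the tempered
    derivative at [c] is genuine and not a default value. *)
Theorem corollary4p4 (R : realType) (b : R) (Psi : R -> R) (hb : 0 < b)
    (Psi_smooth : smooth 0 b Psi)
    (Psi_mono : {in `[0, b] &, {homo Psi : s t / s <= t}})
    (Psi_deriv_pos : {ae lebesgue_measure,
       forall s : R, s \in `[0, b] -> 0 < derive1 Psi s})
    (alpha lambda : R) (halpha : 0 < alpha < 1)
    (y : R -> R) (hy : class_C 1 0 b y) :
  forall t : R, 0 < t <= b ->
  (* the factor 1 / Psi' in the derivative is defined on the range of c *)
  (forall s : R, 0 < s < t -> derive1 Psi s != 0) ->
  exists c : R,
    [/\ 0 < c < t,
        derivable (tempered_integral Psi (1 - alpha) lambda y) c 1 &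
        tempered_RL_derivative Psi alpha lambda y c =
        (expR (lambda * (Psi t - Psi 0)) * y t
         - (Psi t - Psi 0) `^ (alpha - 1) / Gamma alpha
           * value_at_0 (RL_integral Psi (1 - alpha)
               (fun s => expR (lambda * (Psi s - Psi 0)) * y s)))
        / ((Psi t - Psi 0) `^ alpha
           * MittagLeffler 1 (alpha + 1) (lambda * (Psi t - Psi 0)))].
Proof.
move=> t tb Psi'0; have /andP[t0 t_le] := tb.
have [cP dP cP'] := class_C1_itv tb (Psi_smooth 1%N).
have [cy dy cy'] := class_C1_itv tb hy.
have P'neq0 : {in `]0, t[, forall s, derive1 Psi s != 0}.
  by move=> s; rewrite in_itv/=; exact: Psi'0.
have mP : {in `[0, t] &, {homo Psi : s u / s <= u}}.
  have sub r : r \in `[0, t] -> r \in `[0, b].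
    by rewrite !in_itv/= => /andP[-> /le_trans]; apply.
  by move=> s u /sub sb /sub; exact: Psi_mono.
have iP := homo_lt_of_derive1_neq0 cP dP mP P'neq0.
apply: (tempered_mean_value lambda halpha t0 cP iP dP cP' _ cy dy cy') => s st.
(* Monotonicity gives a nonnegative derivative, which being nonzero is positive at every point of
   []0, t[]. *)
rewrite lt_neqAle eq_sym P'neq0//=.
apply: (incr_derive1_ge0_itv (b0 := true) (b1 := false) _ iP st) => r.
by rewrite inE; exact: dP.
Qed.
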